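(* Let $J_C:CR^1_0(\mathcal T)\to S^1_0(\mathcal T)$ be any map such that for every $v_{CR}\in CR^1_0(\mathcal T)$ and every interior node $z\in\mathcal N(\Omega)$, $$J_Cv_{CR}(z)\in\operatorname{conv}\{v_{CR}|_T(z):\ T\in\mathcal T(z)\}.$$ Let $c_{apx}^2:=\frac{\sqrt3}{2}\cot(\omega_0)/(1-\cos(\pi/M_{patch}))$. Then every $v_{CR}\in CR^1_0(\mathcal T)$ satisfies $$\|h_{\mathcal T}^{-1}(v_{CR}-J_Cv_{CR})\|_{L^2(\Omega)}\le c_{apx}\|\nabla_{NC}v_{CR}\|_{L^2(\Omega)}$$ and, for every $T\in\mathcal T$, $$\|h_T^{-1}(v_{CR}-J_Cv_{CR})\|_{L^2(T)}\le c_{apx}\|\nabla_{NC}v_{CR}\|_{L^2(\omega_T)}.$$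
   Context: $\Omega\subset\mathbb R^2$ is a bounded polygonal Lipschitz domain and $\mathcal T$ a regular triangulation of $\Omega$ into triangles; $\omega_0>0$ is a lower bound for all interior angles of triangles in $\mathcal T$. $\mathcal N$, $\mathcal N(\Omega)$, $\mathcal N(\partial\Omega)$ denote all / interior / boundary vertices; $\mathcal T(z)=\{T\in\mathcal T: z\text{ vertex of }T\}$, $\omega_z=\bigcup\mathcal T(z)$, $\omega_T=\bigcup_{z\text{ vertex of }T}\omega_z$. $M_{int}=\max_{z\in\mathcal N(\Omega)}|\mathcal T(z)|$, $M_{bd}=\max_{z\in\mathcal N(\partial\Omega)}|\mathcal T(z)|$, $M_{patch}=\max\{M_{int},M_{bd}\}$. $h_T=\operatorname{diam}(T)$ and $h_{\mathcal T}|_T=h_T$. $S^1_0(\mathcal T)$ is the space of continuous piecewise affine functions vanishing on $\partial\Omega$; $CR^1_0(\mathcal T)$ is the Crouzeix–Raviart space of piecewise affine functions continuous at the midpoints of interior edges and vanishing at midpoints of boundary edges; $\nabla_{NC}$ is the piecewise gradient. *)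

(* Defs.v *)
From Stdlib Require Import Reals Lra List ClassicalEpsilon.
Import ListNotations.
Open Scope R_scope.

Definition pt : Type := (R * R)%type.
Definition padd (p q : pt) : pt := (fst p + fst q, snd p + snd q).
Definition psub (p q : pt) : pt := (fst p - fst q, snd p - snd q).
Definition pscal (t : R) (p : pt) : pt := (t * fst p, t * snd p).
Definition dot (p q : pt) : R := fst p * fst q + snd p * snd q.
Definition pnorm (p : pt) : R := sqrt (dot p p).
Definition dist (p q : pt) : R := pnorm (psub p q).
Definition mid (p q : pt) : pt := pscal (/2) (padd p q).

Definition in_conv_pt (S : pt -> Prop) (x : pt) : Prop :=
  exists l : list (R * pt),
    Forall (fun wp => 0 <= fst wp /\ S (snd wp)) l /\
    fold_right Rplus 0 (map fst l) = 1 /\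
    x = fold_right padd (0, 0) (map (fun wp => pscal (fst wp) (snd wp)) l).

Definition in_conv_R (S : R -> Prop) (y : R) : Prop :=
  exists l : list (R * R),
    Forall (fun wp => 0 <= fst wp /\ S (snd wp)) l /\
    fold_right Rplus 0 (map fst l) = 1 /\
    y = fold_right Rplus 0 (map (fun wp => fst wp * snd wp) l).

Definition ball (x : pt) (r : R) (y : pt) : Prop := dist y x < r.
Definition open_set (O : pt -> Prop) : Prop :=
  forall x, O x -> exists r, 0 < r /\ forall y, ball x r y -> O y.
Definition closure (O : pt -> Prop) (x : pt) : Prop :=
  forall r, 0 < r -> exists y, O y /\ ball x r y.
Definition bdry (O : pt -> Prop) (x : pt) : Prop := closure O x /\ ~ O x.
Definition bounded_set (O : pt -> Prop) : Prop :=
  exists M, forall x, O x -> pnorm x <= M.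
Definition connected_set (O : pt -> Prop) : Prop :=
  forall U V : pt -> Prop, open_set U -> open_set V ->
    (forall x, O x -> U x \/ V x) -> (forall x, O x -> U x -> V x -> False) ->
    (exists x, O x /\ U x) -> (exists x, O x /\ V x) -> False.

Definition rot (th : R) (p : pt) : pt :=
  (cos th * fst p - sin th * snd p, sin th * fst p + cos th * snd p).

Definition lipschitz_domain (O : pt -> Prop) : Prop :=
  open_set O /\ bounded_set O /\ connected_set O /\
  forall x0, bdry O x0 ->
    exists (th r h L : R) (g : R -> R),
      0 < r /\ 0 < h /\
      (forall s t, Rabs (g s - g t) <= L * Rabs (s - t)) /\
      forall x, let y := rot th (psub x x0) in
        Rabs (fst y) < r -> Rabs (snd y) < h ->
        (O x <-> snd y < g (fst y)).

Record tri : Type := Tri { tA : pt; tB : pt; tC : pt }.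
Definition dflt_tri : tri := Tri (0,0) (0,0) (0,0).

Definition is_vertex (z : pt) (T : tri) : Prop := z = tA T \/ z = tB T \/ z = tC T.
Definition in_tri (T : tri) (x : pt) : Prop :=
  in_conv_pt (fun z => is_vertex z T) x.
Definition det2 (p q : pt) : R := fst p * snd q - snd p * fst q.
Definition area (T : tri) : R :=
  Rabs (det2 (psub (tB T) (tA T)) (psub (tC T) (tA T))) / 2.
Definition diam (T : tri) : R :=
  Rmax (dist (tA T) (tB T)) (Rmax (dist (tB T) (tC T)) (dist (tC T) (tA T))).
Definition angle (a b c : pt) : R :=
  acos (dot (psub b a) (psub c a) / (pnorm (psub b a) * pnorm (psub c a))).
Definition min_angle_ge (T : tri) (w : R) : Prop :=
  w <= angle (tA T) (tB T) (tC T) /\ w <= angle (tB T) (tC T) (tA T) /\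
  w <= angle (tC T) (tA T) (tB T).

Definition triT (tris : list tri) (i : nat) : tri := nth i tris dflt_tri.
Definition is_node (tris : list tri) (z : pt) : Prop :=
  exists i, (i < length tris)%nat /\ is_vertex z (triT tris i).

(** regular (conforming) triangulation of O: nondegenerate triangles covering
    the closure of O, two distinct triangles meet in the convex hull of their
    common vertices (empty set, common vertex, or common edge). *)
Definition regular_triangulation (O : pt -> Prop) (tris : list tri) : Prop :=
  (forall i, (i < length tris)%nat -> 0 < area (triT tris i)) /\
  (forall x, closure O x <-> exists i, (i < length tris)%nat /\ in_tri (triT tris i) x) /\
  (forall i j, (i < length tris)%nat -> (j < length tris)%nat -> i <> j ->
     ~ (forall z, is_vertex z (triT tris i) <-> is_vertex z (triT tris j)) /\
     forall x, (in_tri (triT tris i) x /\ in_tri (triT tris j) x) <->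
       in_conv_pt (fun z => is_vertex z (triT tris i) /\ is_vertex z (triT tris j)) x).

Definition pt_eq_dec (p q : pt) : {p = q} + {p <> q}.
Proof.
  destruct p as [p1 p2], q as [q1 q2].
  destruct (Req_EM_T p1 q1) as [->|H1]; [|right; intro E; inversion E; auto].
  destruct (Req_EM_T p2 q2) as [->|H2]; [left; reflexivity|right; intro E; inversion E; auto].
Defined.
Definition is_vertexb (z : pt) (T : tri) : bool :=
  if pt_eq_dec z (tA T) then true else
  if pt_eq_dec z (tB T) then true else
  if pt_eq_dec z (tC T) then true else false.
Definition patch_size (tris : list tri) (z : pt) : nat :=
  length (filter (is_vertexb z) tris).
Definition nodes (tris : list tri) : list pt :=
  flat_map (fun T => [tA T; tB T; tC T]) tris.
Definition propb (P : Prop) : bool :=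
  if excluded_middle_informative P then true else false.
Definition M_int (O : pt -> Prop) (tris : list tri) : nat :=
  fold_right Nat.max 0%nat
    (map (patch_size tris) (filter (fun z => propb (O z)) (nodes tris))).
Definition M_bd (O : pt -> Prop) (tris : list tri) : nat :=
  fold_right Nat.max 0%nat
    (map (patch_size tris) (filter (fun z => propb (bdry O z)) (nodes tris))).
Definition M_patch (O : pt -> Prop) (tris : list tri) : nat :=
  Nat.max (M_int O tris) (M_bd O tris).

(** * Integration over a triangle: limit of Riemann sums (centroid rule) on the
    uniform red refinements (mesh size -> 0). *)
Definition centroid (T : tri) : pt :=
  pscal (/3) (padd (tA T) (padd (tB T) (tC T))).
Definition red_refine (T : tri) : list tri :=
  let a := tA T in let b := tB T in let c := tC T in
  [Tri a (mid a b) (mid c a); Tri (mid a b) b (mid b c);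
   Tri (mid c a) (mid b c) c; Tri (mid b c) (mid c a) (mid a b)].
Fixpoint refine_k (k : nat) (T : tri) : list tri :=
  match k with
  | O => [T]
  | S k' => flat_map red_refine (refine_k k' T)
  end.
Definition riemann_sum (T : tri) (f : pt -> R) (k : nat) : R :=
  fold_right Rplus 0 (map (fun S => area S * f (centroid S)) (refine_k k T)).
Definition tri_integral (T : tri) (f : pt -> R) : R :=
  epsilon (inhabits 0) (fun I => Un_cv (riemann_sum T f) I).

Definition d1 (f : pt -> R) (x : pt) : R :=
  epsilon (inhabits 0) (fun l => derivable_pt_lim (fun t => f (t, snd x)) (fst x) l).
Definition d2 (f : pt -> R) (x : pt) : R :=
  epsilon (inhabits 0) (fun l => derivable_pt_lim (fun t => f (fst x, t)) (snd x) l).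
Definition grad_sq (f : pt -> R) (x : pt) : R := d1 f x ^ 2 + d2 f x ^ 2.

Definition affine (f : pt -> R) : Prop :=
  exists a b c, forall x, f x = a + b * fst x + c * snd x.
Definition on_edge (p q x : pt) : Prop :=
  exists t, 0 <= t <= 1 /\ x = padd p (pscal t (psub q p)).
Definition is_edge (p q : pt) (T : tri) : Prop :=
  p <> q /\ is_vertex p T /\ is_vertex q T.
Definition boundary_edge (O : pt -> Prop) (p q : pt) : Prop :=
  forall x, on_edge p q x -> bdry O x.

(** Crouzeix-Raviart function: v i is the affine function on triangle i. *)
Definition CR10 (O : pt -> Prop) (tris : list tri) (v : nat -> pt -> R) : Prop :=
  (forall i, (i < length tris)%nat -> affine (v i)) /\
  (forall i j p q, (i < length tris)%nat -> (j < length tris)%nat ->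
     is_edge p q (triT tris i) -> is_edge p q (triT tris j) ->
     ~ boundary_edge O p q -> v i (mid p q) = v j (mid p q)) /\
  (forall i p q, (i < length tris)%nat -> is_edge p q (triT tris i) ->
     boundary_edge O p q -> v i (mid p q) = 0).

(** Courant space S^1_0: continuous (global function), affine on each triangle,
    vanishing on the boundary. *)
Definition S10 (O : pt -> Prop) (tris : list tri) (w : pt -> R) : Prop :=
  (forall i, (i < length tris)%nat ->
     exists g, affine g /\ forall x, in_tri (triT tris i) x -> w x = g x) /\
  (forall x, bdry O x -> w x = 0).

Definition err_sq_T (tris : list tri) (v : nat -> pt -> R) (w : pt -> R) (i : nat) : R :=
  tri_integral (triT tris i)
    (fun x => (/ diam (triT tris i) * (v i x - w x)) ^ 2).
Definition grad_sq_T (tris : list tri) (v : nat -> pt -> R) (i : nat) : R :=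
  tri_integral (triT tris i) (fun x => grad_sq (v i) x).
Definition sum_idx (n : nat) (P : nat -> bool) (f : nat -> R) : R :=
  fold_right Rplus 0 (map f (filter P (seq 0 n))).
Definition shares_vertex (T T' : tri) : bool :=
  is_vertexb (tA T) T' || is_vertexb (tB T) T' || is_vertexb (tC T) T'.

Definition cot (x : R) : R := cos x / sin x.

(* Main.v *)
(** On each triangle the error is affine, so its squared norm is at most a third of the area
    times the sum of its squared vertex values, and [area T <= sqrt 3 / 4 * diam T ^ 2].  Around
    a vertex [z], neighbouring values differ by half the difference of the increments of the two
    affine functions along the common edge, because these agree at its midpoint.  The triangles
    at an interior [z] form a cycle along which [v - J v] changes sign, by convexity; those at a
    boundary [z] form chains ending in boundary edges, where [v] vanishes at midpoints.  Either
    way a discrete Poincare inequality with zeros at the two ends of a path of [N] values applies;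
    its elementary constant [(2 N^2 + 1) / 12] is below [1 / (1 - cos (PI / N))].  Summing the
    increments over the three edges of a triangle gives at most [6 cot omega0] times the energy,
    since the cotangents [p, q, r] of the angles satisfy [p, q, r <= cot omega0] and
    [p q + q r + r p = 1].

    No cyclic order is constructed a priori: a longest chain of triangles around [z] either ends
    in two unshared edges or closes up.  In the second case its cones at [z] cover all directions,
    which makes it the whole patch and excludes that [z] is a boundary point of a Lipschitz
    domain. *)
Require Import Defs.
From Stdlib Require Import Bool Reals List Lra Lia Permutation Classical ClassicalEpsilon.
Open Scope R_scope.

(** * Sums and discrete Poincare inequalities *)

(** For zeros at half distance, the best constant on a path of [N] values is
    [1 / (2 (1 - cos (PI / N)))], attained by the values [sin (PI (k + 1/2) / N)]. The theorem
    allows twice that, so eigenvectors can be avoided: each value is bounded by Cauchy-Schwarz from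
    the zero on its left and from the zero on its right, and the two bounds are weighted so that the
    two energies add up to the total.

    Energy is charged to vertices. Half of a squared increment goes to each end of its edge, so the
    three vertices of a triangle together pay for every edge exactly once. The remaining factors
    then multiply out without loss: [sqrt 3 / 4] from the area, [1 / 3] from the mass of an affine
    function and [6 cot omega0] from the increments give [sqrt 3 / 2 * cot omega0]. The factor 6 is
    attained by equilateral triangles with [omega0 = PI / 3]. *)

Definition rsum {A : Type} (f : A -> R) (l : list A) : R :=
  fold_right Rplus 0 (map f l).

Lemma rsum_app {A} (f : A -> R) l1 l2 : rsum f (l1 ++ l2) = rsum f l1 + rsum f l2.
Proof.
  unfold rsum; induction l1 as [|a l IH]; cbn; [ring|rewrite IH; ring].
Qed.

Lemma rsum_ext {A} (f g : A -> R) l :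
  (forall a, In a l -> f a = g a) -> rsum f l = rsum g l.
Proof.
  unfold rsum; induction l as [|a l IH]; cbn; intros H; [reflexivity|].
  rewrite (H a), IH; auto.
Qed.

Lemma rsum_le {A} (f g : A -> R) l :
  (forall a, In a l -> f a <= g a) -> rsum f l <= rsum g l.
Proof.
  unfold rsum; induction l as [|a l IH]; cbn; intros H; [lra|].
  apply Rplus_le_compat; auto.
Qed.

Lemma rsum_nonneg {A} (f : A -> R) l :
  (forall a, In a l -> 0 <= f a) -> 0 <= rsum f l.
Proof.
  unfold rsum; induction l as [|a l IH]; cbn; intros H; [lra|].
  apply Rplus_le_le_0_compat; auto.
Qed.

Lemma rsum_ge_term {A} (f : A -> R) l a :
  (forall b, In b l -> 0 <= f b) -> In a l -> f a <= rsum f l.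
Proof.
  intros Hf Ha. destruct (in_split _ _ Ha) as [l1 [l2 ->]].
  rewrite rsum_app. change (rsum f (a :: l2)) with (f a + rsum f l2).
  assert (H1 : 0 <= rsum f l1) by (apply rsum_nonneg; intros; apply Hf, in_or_app; auto).
  assert (H2 : 0 <= rsum f l2) by (apply rsum_nonneg; intros; apply Hf, in_or_app; cbn; auto).
  lra.
Qed.

Lemma rsum_plus {A} (f g : A -> R) l :
  rsum (fun a => f a + g a) l = rsum f l + rsum g l.
Proof.
  unfold rsum; induction l as [|a l IH]; cbn; [ring|rewrite IH; ring].
Qed.

Lemma rsum_scal {A} c (f : A -> R) l : rsum (fun a => c * f a) l = c * rsum f l.
Proof.
  unfold rsum; induction l as [|a l IH]; cbn; [ring|rewrite IH; ring].
Qed.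

Lemma rsum_map {A B} (f : B -> R) (h : A -> B) l :
  rsum f (map h l) = rsum (fun a => f (h a)) l.
Proof. unfold rsum; now rewrite map_map. Qed.

Lemma rsum_perm {A} (f : A -> R) l1 l2 : Permutation l1 l2 -> rsum f l1 = rsum f l2.
Proof.
  unfold rsum; induction 1; cbn; try lra.
Qed.

Lemma rsum_filter {A} (f : A -> R) P l :
  rsum f (filter P l) = rsum (fun a => if P a then f a else 0) l.
Proof.
  unfold rsum; induction l as [|a l IH]; cbn; [ring|].
  destruct (P a); cbn; rewrite IH; ring.
Qed.

Lemma rsum_exchange {A B} (f : A -> B -> R) l1 l2 :
  rsum (fun a => rsum (f a) l2) l1 = rsum (fun b => rsum (fun a => f a b) l1) l2.
Proof.
  induction l1 as [|a l IH].
  - unfold rsum at 1; cbn. rewrite (rsum_ext _ (fun _ => 0 * 0)) by (intros; cbn; ring).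
    rewrite rsum_scal; ring.
  - change (rsum (f a) l2 + rsum (fun a => rsum (f a) l2) l =
            rsum (fun b => f a b + rsum (fun a => f a b) l) l2).
    rewrite IH, <- rsum_plus; reflexivity.
Qed.

Lemma rsum_seq_S (f : nat -> R) n :
  rsum f (seq 0 (S n)) = rsum f (seq 0 n) + f n.
Proof. rewrite seq_S, rsum_app; unfold rsum at 2; cbn; ring. Qed.

Lemma rsum_seq_shift (f : nat -> R) n :
  rsum f (seq 0 (S n)) = f 0%nat + rsum (fun k => f (S k)) (seq 0 n).
Proof.
  change (f 0%nat + rsum f (seq 1 n) = f 0%nat + rsum (fun k => f (S k)) (seq 0 n)).
  now rewrite <- seq_shift, rsum_map.
Qed.

Lemma rsum_periodic (f : nat -> R) m s :
  (forall k, f (k + m)%nat = f k) ->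
  rsum (fun k => f (s + k)%nat) (seq 0 m) = rsum f (seq 0 m).
Proof.
  intros Hf; induction s as [|s IH]; [reflexivity|].
  rewrite <- IH.
  assert (E := rsum_seq_S (fun k => f (s + k)%nat) m).
  rewrite rsum_seq_shift, Hf, Nat.add_0_r in E.
  rewrite (rsum_ext _ (fun k => f (s + S k)%nat)); [lra|].
  intros k _; f_equal; lia.
Qed.

(* Two-term Cauchy-Schwarz with weights [A] and [1]. *)
Lemma square_step a b A P g :
  0 <= A -> 0 <= P -> a ^ 2 <= A * P -> (a - b) ^ 2 <= g ->
  b ^ 2 <= (A + 1) * (P + g).
Proof.
  intros HA HP H1 H2.
  set (s := b - a). assert (Hs : s ^ 2 <= g) by (unfold s; nra).
  replace b with (a + s) by (unfold s; ring).
  assert (0 <= s ^ 2) by nra.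
  (* The mixed term is at most [P + A g], because [a^2 s^2 <= A P g] and
     [4 A P g <= (P + A g)^2]. *)
  assert (Hx : (2 * a * s) ^ 2 <= (P + A * g) ^ 2).
  { assert (a ^ 2 * s ^ 2 <= (A * P) * g) by (apply Rmult_le_compat; nra).
    assert (Hq := pow2_ge_0 (P - A * g)). lra. }
  assert (0 <= P + A * g) by nra.
  assert (2 * a * s <= P + A * g).
  { apply Rle_trans with (Rabs (2 * a * s)); [apply RRle_abs|].
    rewrite <- (Rabs_pos_eq (P + A * g)) by assumption.
    apply Rsqr_le_abs_0; unfold Rsqr; lra. }
  nra.
Qed.

(** The summand is the product of the distances from the [k]-th value to the two zeros, the weight
    it gets in [path_poincare] for [M = INR N]. *)
Lemma rsum_parabola r M n :
  rsum (fun k => (r + INR k) * (M - r - INR k)) (seq 0 n) =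
  INR n * (r * (M - r) + (M - 2 * r) * (INR n - 1) / 2 - (INR n - 1) * (2 * INR n - 1) / 6).
Proof.
  induction n as [|n IH]; [unfold rsum; cbn; ring|].
  rewrite rsum_seq_S, IH, S_INR; field.
Qed.

(* Poincare inequality on a path of [N] values pinned to zero at both ends: the
   zeros sit at distance [r] before the first and [1 - r] after the last value. *)
Lemma path_poincare N (x G : nat -> R) r gl gr :
  (1 <= N)%nat -> 0 <= r <= 1 -> 0 <= gl -> 0 <= gr ->
  x 0%nat ^ 2 <= r * gl -> x (N - 1)%nat ^ 2 <= (1 - r) * gr ->
  (forall k, (S k < N)%nat -> (x k - x (S k)) ^ 2 <= G k) ->
  rsum (fun k => x k ^ 2) (seq 0 N) <=
    (2 * INR N ^ 2 + 1) / 12 * (gl + rsum G (seq 0 (N - 1)) + gr).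
Proof.
  intros HN Hr Hgl Hgr H0 H1 HG.
  (* [pre k] is the energy to the left of the value [x k], so [tot - pre k] is the energy to its
     right. *)
  set (pre := fun k => gl + rsum G (seq 0 k)).
  set (tot := gl + rsum G (seq 0 (N - 1)) + gr).
  assert (preS : forall k, pre (S k) = pre k + G k).
  { intros k; unfold pre; rewrite rsum_seq_S; ring. }
  assert (HGn : forall k, (S k < N)%nat -> 0 <= G k).
  { intros k Hk. specialize (HG k Hk). assert (Hq := pow2_ge_0 (x k - x (S k))). lra. }
  assert (Hp : forall k, (k < N)%nat -> 0 <= pre k /\ x k ^ 2 <= (r + INR k) * pre k).
  { induction k as [|k IH]; intros Hk.
    - unfold pre, rsum; cbn. split; [lra|]. cbn in H0; lra.
    - destruct IH as [I1 I2]; [lia|]. specialize (HG k Hk); specialize (HGn k Hk).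
      rewrite preS, S_INR. split; [lra|].
      assert (HA := pos_INR k).
      rewrite <- Rplus_assoc.
      apply square_step with (x k); lra. }
  assert (Hs : forall i, (i < N)%nat ->
     0 <= tot - pre (N - 1 - i)%nat /\
     x (N - 1 - i)%nat ^ 2 <= (1 - r + INR i) * (tot - pre (N - 1 - i)%nat)).
  { induction i as [|i IH]; intros Hi.
    - rewrite Nat.sub_0_r. replace (tot - pre (N - 1)%nat) with gr by (unfold tot, pre; ring).
      cbn [INR]. split; [lra|]. rewrite Rplus_0_r. exact H1.
    - destruct IH as [I1 I2]; [lia|].
      replace (N - 1 - i)%nat with (S (N - 1 - S i)) in I1, I2 by lia.
      set (k := (N - 1 - S i)%nat) in *.
      assert (Hk : (S k < N)%nat) by (unfold k; lia).
      specialize (HG k Hk); specialize (HGn k Hk). rewrite preS in I1, I2.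
      replace (tot - pre k) with (tot - (pre k + G k) + G k) by ring.
      rewrite S_INR. split; [lra|]. assert (HA := pos_INR i).
      rewrite <- Rplus_assoc. apply square_step with (x (S k)); lra. }
  assert (HN1 : 1 <= INR N) by (apply (le_INR 1); lia).
  (* With [A] the distance to the left zero, the left bound is multiplied by [INR N - A] and the
     right bound by [A]; both then carry the factor [A (INR N - A)], and the energies add up to
     [tot]. *)
  assert (Hk : forall k, In k (seq 0 N) ->
    INR N * x k ^ 2 <= tot * ((r + INR k) * (INR N - r - INR k))).
  { intros k Hk; apply in_seq in Hk.
    destruct (Hp k) as [P1 P2]; [lia|].
    destruct (Hs (N - 1 - k)%nat) as [S1 S2]; [lia|].
    replace (N - 1 - (N - 1 - k))%nat with k in S1, S2 by lia.
    rewrite 2!minus_INR in S2 by lia. cbn [INR] in S2.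
    assert (HA := pos_INR k).
    assert (HB : INR k + 1 <= INR N) by (rewrite <- S_INR; apply le_INR; lia).
    set (A := r + INR k) in *.
    replace (INR N - r - INR k) with (INR N - A) by (unfold A; ring).
    replace (1 - r + (INR N - 1 - INR k)) with (INR N - A) in S2 by (unfold A; ring).
    assert (0 <= A) by (unfold A; lra). assert (0 <= INR N - A) by (unfold A; lra).
    assert ((INR N - A) * x k ^ 2 <= (INR N - A) * (A * pre k))
      by (apply Rmult_le_compat_l; lra).
    assert (A * x k ^ 2 <= A * ((INR N - A) * (tot - pre k)))
      by (apply Rmult_le_compat_l; lra).
    lra. }
  apply rsum_le in Hk. rewrite !rsum_scal, rsum_parabola in Hk.
  assert (Htot : 0 <= tot).
  { destruct (Hs 0%nat) as [S1 _]; [lia|]. destruct (Hp (N - 1 - 0)%nat); [lia|]. lra. }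
  fold tot.
  apply Rmult_le_reg_l with (INR N); [lra|].
  eapply Rle_trans; [exact Hk|].
  replace (INR N * ((2 * INR N ^ 2 + 1) / 12 * tot)) with
    (tot * (INR N * ((2 * INR N ^ 2 + 1) / 12))) by ring.
  apply Rmult_le_compat_l; [exact Htot|]. apply Rmult_le_compat_l; [lra|].
  (* The mean of the parabola is [(2 N^2 + 1) / 12 - (r - 1/2)^2], largest for zeros at half
     distance. *)
  assert (Hq := pow2_ge_0 (r - / 2)). nra.
Qed.

(* A sign change of a cyclic sequence lets one cut the cycle at an interpolated
   zero, which reduces the cyclic inequality to the one on a path. *)
Lemma cycle_poincare m (x G : nat -> R) :
  (1 <= m)%nat ->
  (forall k, x (k + m)%nat = x k) -> (forall k, G (k + m)%nat = G k) ->
  (forall k, (x k - x (S k)) ^ 2 <= G k) ->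
  (exists i, (i < m)%nat /\ x i <= 0) -> (exists j, (j < m)%nat /\ 0 <= x j) ->
  rsum (fun k => x k ^ 2) (seq 0 m) <=
    (2 * INR m ^ 2 + 1) / 12 * rsum G (seq 0 m).
Proof.
  intros Hm Hx HGp HG [i [Hi Hxi]] [j [Hj Hxj]].
  (* Without an upward crossing the values stay nonpositive from index [i] on; but [x (j + m) = x j]
     is nonnegative, so a crossing occurs at [j + m - 1] at the latest. *)
  assert (Hs : exists s, x s <= 0 <= x (S s)).
  { apply NNPP; intros Hn.
    assert (H : forall k, x (i + k)%nat <= 0).
    { induction k as [|k IH]; [now rewrite Nat.add_0_r|].
      apply Rnot_lt_le; intros H. apply Hn; exists (i + k)%nat.
      replace (S (i + k)) with (i + S k)%nat by lia. lra. }
    apply Hn; exists (j + m - 1)%nat. split.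
    - specialize (H (j + m - 1 - i)%nat).
      now replace (i + (j + m - 1 - i))%nat with (j + m - 1)%nat in H by lia.
    - replace (S (j + m - 1)) with (j + m)%nat by lia. now rewrite Hx. }
  destruct Hs as [s [Hs1 Hs2]].
  rewrite <- (rsum_periodic (fun k => x k ^ 2) m (S s)) by (intros; now rewrite Hx).
  rewrite <- (rsum_periodic G m (S s)) by auto.
  set (y := fun k => x (S s + k)%nat). set (g := fun k => G (S s + k)%nat).
  change (rsum (fun k => y k ^ 2) (seq 0 m) <= (2 * INR m ^ 2 + 1) / 12 * rsum g (seq 0 m)).
  assert (Hy0 : 0 <= y 0%nat) by (unfold y; rewrite Nat.add_0_r; exact Hs2).
  assert (Hy1 : y (m - 1)%nat = x s).
  { unfold y. rewrite <- (Hx s). f_equal; lia. }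
  assert (Hg : (y 0%nat - y (m - 1)%nat) ^ 2 <= g (m - 1)%nat).
  { rewrite Hy1. unfold y, g. rewrite Nat.add_0_r.
    replace (S s + (m - 1))%nat with (s + m)%nat by lia. rewrite HGp.
    specialize (HG s). nra. }
  set (a := y 0%nat) in *. set (b := - y (m - 1)%nat).
  assert (Hb : 0 <= b) by (unfold b; lra).
  assert (Hab : (a + b) ^ 2 <= g (m - 1)%nat) by (unfold b; lra).
  (* The interpolated zero divides the cut link in the ratio [a : b]; the energy of that link is
     shared between the two ends of the path in the ratio [r : 1 - r]. *)
  assert (Hr : exists r, 0 <= r <= 1 /\ a = r * (a + b)).
  { destruct (Req_dec (a + b) 0) as [E|E].
    - exists 0. split; lra.
    - exists (a / (a + b)). split; [|field; lra]. assert (0 < a + b) by lra.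
      assert (a / (a + b) * (a + b) = a) by (field; lra).
      split; nra. }
  destruct Hr as [r [Hr Ha]].
  assert (Hg0 : 0 <= g (m - 1)%nat) by (assert (Hq := pow2_ge_0 (a + b)); lra).
  assert (E : rsum g (seq 0 m) = r * g (m - 1)%nat + rsum g (seq 0 (m - 1)) + (1 - r) * g (m - 1)%nat).
  { replace m with (S (m - 1)) at 1 by lia. rewrite rsum_seq_S. ring. }
  rewrite E.
  apply path_poincare with (r := r); auto.
  - apply Rmult_le_pos; lra.
  - apply Rmult_le_pos; lra.
  - fold a. rewrite Ha. replace ((r * (a + b)) ^ 2) with (r * (r * (a + b) ^ 2)) by ring.
    apply Rmult_le_compat_l; [lra|]. apply Rmult_le_compat_l; [lra|]. exact Hab.
  - replace (y (m - 1)%nat ^ 2) with ((1 - r) * ((1 - r) * (a + b) ^ 2)).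
    + apply Rmult_le_compat_l; [lra|]. apply Rmult_le_compat_l; [lra|]. exact Hab.
    + replace (y (m - 1)%nat) with (- ((a + b) - a)) by (unfold b; ring).
      rewrite Ha at 3. ring.
  - intros k _. unfold y, g. replace (S s + S k)%nat with (S (S s + k)) by lia. apply HG.
Qed.

(** * Chains of triangles around a vertex *)

(* [inc t p]: the triangle of index [t] in a patch has the spoke ending in [p]. *)
Definition two_spokes (inc : nat -> pt -> Prop) (l : list nat) : Prop :=
  forall t, In t l -> exists p q, p <> q /\ forall y, inc t y <-> y = p \/ y = q.

Definition spokes_at_most_double (inc : nat -> pt -> Prop) (l : list nat) : Prop :=
  forall t1 t2 t3 p, In t1 l -> In t2 l -> In t3 l ->
    inc t1 p -> inc t2 p -> inc t3 p -> t1 = t2 \/ t1 = t3 \/ t2 = t3.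

(** Triangle [T k] lies between the spokes [P k] and [P (S k)]. Only the triangles have to be
    distinct, so a chain may close up with [P 0 = P m]. *)
Definition chain (inc : nat -> pt -> Prop) (l : list nat) (m : nat)
    (T : nat -> nat) (P : nat -> pt) : Prop :=
  (forall k, (k < m)%nat -> In (T k) l) /\
  (forall j k, (j < m)%nat -> (k < m)%nat -> T j = T k -> j = k) /\
  (forall k, (k < m)%nat -> inc (T k) (P k) /\ inc (T k) (P (S k)) /\ P k <> P (S k)).

Lemma two_spokes_other inc l t p :
  two_spokes inc l -> In t l -> inc t p -> exists q, inc t q /\ p <> q.
Proof.
  intros H Ht Hp. destruct (H t Ht) as [a [b [Hab E]]].
  apply E in Hp. destruct Hp as [Hp|Hp]; subst p.
  - exists b. split; [apply E; auto|auto].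
  - exists a. split; [apply E; auto|auto].
Qed.

Lemma two_spokes_cases inc l t p q y :
  two_spokes inc l -> In t l -> inc t p -> inc t q -> p <> q -> inc t y ->
  y = p \/ y = q.
Proof.
  intros H Ht Hp Hq Hpq Hy. destruct (H t Ht) as [a [b [Hab E]]].
  apply E in Hp; apply E in Hq; apply E in Hy.
  destruct Hp, Hq, Hy; subst; tauto.
Qed.

Lemma NoDup_map_seq (T : nat -> nat) m :
  (forall j k, (j < m)%nat -> (k < m)%nat -> T j = T k -> j = k) ->
  NoDup (map T (seq 0 m)).
Proof.
  intros H. apply NoDup_map_NoDup_ForallPairs; [|apply seq_NoDup].
  intros a b Ha Hb. apply in_seq in Ha; apply in_seq in Hb. apply H; lia.
Qed.

Lemma chain_length inc l m T P : chain inc l m T P -> (m <= length l)%nat.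
Proof.
  intros [H1 [H2 _]].
  replace m with (length (map T (seq 0 m))) by now rewrite length_map, length_seq.
  apply NoDup_incl_length; [apply NoDup_map_seq; exact H2|].
  intros t Ht. apply in_map_iff in Ht as [k [<- Hk]]. apply in_seq in Hk. apply H1; lia.
Qed.

Lemma chain_rev inc l m T P :
  chain inc l m T P ->
  chain inc l m (fun k => T (m - 1 - k)%nat) (fun k => P (m - k)%nat).
Proof.
  intros [H1 [H2 H3]]. repeat split.
  - intros k Hk. apply H1; lia.
  - intros j k Hj Hk E. apply H2 in E; lia.
  - replace (m - k)%nat with (S (m - 1 - k)) by lia. apply H3; lia.
  - replace (m - S k)%nat with (m - 1 - k)%nat by lia. apply H3; lia.
  - replace (m - k)%nat with (S (m - 1 - k)) by lia.
    replace (m - S k)%nat with (m - 1 - k)%nat by lia.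
    apply not_eq_sym, H3; lia.
Qed.

(** A triangle outside the chain could be appended at [P m]. A triangle [T i] before the last one
    has only the spokes [P i] and [P (S i)]; an inner spoke already has two triangles, and the last
    triangle would be a third, so only [P m = P 0] remains. *)
Lemma chain_last_spoke inc l m T P t :
  two_spokes inc l -> spokes_at_most_double inc l ->
  (1 <= m)%nat -> chain inc l m T P ->
  (forall T' P', ~ chain inc l (S m) T' P') ->
  In t l -> inc t (P m) -> t = T (m - 1)%nat \/ P 0%nat = P m.
Proof.
  intros H2 H3 Hm [C1 [C2 C3]] Hmax Ht Hp.
  destruct (classic (exists i, (i < m)%nat /\ t = T i)) as [[i [Hi ->]]|Hn].
  - destruct (Nat.eq_dec i (m - 1)) as [->|Hne]; [now left|right].
    destruct (C3 (m - 1)%nat) as [_ [L1 L2]]; [lia|].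
    replace (S (m - 1)) with m in L1, L2 by lia.
    destruct (C3 i Hi) as [I1 [I2 I3]].
    destruct (two_spokes_cases inc l (T i) (P i) (P (S i)) (P m)) as [E|E]; auto.
    + destruct i as [|i]; [now symmetry|exfalso].
      destruct (C3 i) as [J1 [J2 J3]]; [lia|]. rewrite <- E in J2.
      destruct (H3 (T i) (T (S i)) (T (m - 1)%nat) (P m)) as [X|[X|X]];
        auto; try (apply C1; lia); apply C2 in X; lia.
    + exfalso. destruct (C3 (S i)) as [J1 [J2 J3]]; [lia|]. rewrite <- E in J1, J3.
      destruct (H3 (T i) (T (S i)) (T (m - 1)%nat) (P m)) as [X|[X|X]];
        auto; try (apply C1; lia); apply C2 in X; try lia.
      rewrite <- X in L2. congruence.
  - exfalso. destruct (two_spokes_other inc l t (P m) H2 Ht Hp) as [q [Hq Hpq]].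
    apply (Hmax (fun k => if Nat.eq_dec k m then t else T k)
                (fun k => if Nat.eq_dec k (S m) then q else P k)).
    repeat split.
    + intros k Hk. destruct (Nat.eq_dec k m); [auto|apply C1; lia].
    + intros j k Hj Hk E.
      destruct (Nat.eq_dec j m), (Nat.eq_dec k m); try lia.
      * exfalso; apply Hn; exists k; split; [lia|auto].
      * exfalso; apply Hn; exists j; split; [lia|auto].
      * apply C2 in E; lia.
    + destruct (Nat.eq_dec k (S m)), (Nat.eq_dec k m); try lia; subst; auto. apply C3; lia.
    + destruct (Nat.eq_dec (S k) (S m)), (Nat.eq_dec k m); try lia; subst; auto. apply C3; lia.
    + destruct (Nat.eq_dec k (S m)), (Nat.eq_dec (S k) (S m)); try lia.
      * replace k with m by lia. auto.
      * apply C3; lia.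
Qed.

(** Chain lengths are bounded by [length l], so some length [m] occurs while [m + 1] does not. That
    maximality also holds for the reversed chain, hence one lemma treats both ends. *)
Lemma chain_maximal inc l :
  two_spokes inc l -> spokes_at_most_double inc l -> l <> nil ->
  exists m T P, (1 <= m)%nat /\ chain inc l m T P /\
    (P 0%nat = P m \/
     (forall t, In t l -> inc t (P 0%nat) -> t = T 0%nat) /\
     (forall t, In t l -> inc t (P m) -> t = T (m - 1)%nat)).
Proof.
  intros H2 H3 Hl.
  assert (Hex : exists m T P, (1 <= m)%nat /\ chain inc l m T P).
  { destruct l as [|t l]; [tauto|]. destruct (H2 t) as [p [q [Hpq E]]]; [now left|].
    exists 1%nat, (fun _ => t), (fun k => if Nat.eq_dec k 0 then p else q).
    split; [lia|]. repeat split.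
    - intros; now left.
    - lia.
    - destruct (Nat.eq_dec k 0); apply E; auto.
    - cbn; apply E; auto.
    - replace k with 0%nat by lia. exact Hpq. }
  assert (Hmax : exists m T P, (1 <= m)%nat /\ chain inc l m T P /\
                   forall T' P', ~ chain inc l (S m) T' P').
  { apply NNPP; intros Hn.
    assert (H : forall n, exists m T P, (n < m)%nat /\ chain inc l m T P).
    { induction n as [|n IH].
      - destruct Hex as [m [T [P [Hm C]]]]. exists m, T, P. split; [lia|exact C].
      - destruct IH as [m [T [P [Hm C]]]]. apply NNPP; intros Hn'. apply Hn.
        exists m, T, P. split; [lia|]. split; [exact C|].
        intros T' P' C'. apply Hn'. exists (S m), T', P'. split; [lia|exact C']. }
    destruct (H (length l)) as [m [T [P [Hm C]]]]. apply chain_length in C. lia. }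
  destruct Hmax as [m [T [P [Hm [C Hmx]]]]].
  exists m, T, P. split; [exact Hm|]. split; [exact C|].
  destruct (classic (P 0%nat = P m)) as [E|E]; [now left|right].
  split; intros t Ht Hp.
  - destruct (chain_last_spoke inc l m _ _ t H2 H3 Hm (chain_rev _ _ _ _ _ C) Hmx) as [X|X]; auto.
    + now rewrite Nat.sub_diag.
    + rewrite X. f_equal; lia.
    + rewrite Nat.sub_diag, Nat.sub_0_r in X. congruence.
  - destruct (chain_last_spoke inc l m T P t H2 H3 Hm C Hmx) as [X|X]; auto; congruence.
Qed.

Definition in_chain (m : nat) (T : nat -> nat) (t : nat) : bool :=
  propb (exists k, (k < m)%nat /\ t = T k).

Lemma propb_true P : propb P = true <-> P.
Proof. unfold propb; destruct excluded_middle_informative; split; auto; discriminate. Qed.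

Lemma rsum_chain inc l m T P (f : nat -> R) :
  NoDup l -> chain inc l m T P ->
  rsum f l = rsum (fun k => f (T k)) (seq 0 m) +
             rsum f (filter (fun t => negb (in_chain m T t)) l).
Proof.
  intros Hl [C1 [C2 _]].
  rewrite <- (rsum_map f T), <- rsum_app. apply rsum_perm.
  apply NoDup_Permutation; [exact Hl| |].
  - apply NoDup_app.
    + now apply NoDup_map_seq.
    + now apply NoDup_filter.
    + intros t Ht Hf. apply filter_In in Hf as [_ Hf].
      apply in_map_iff in Ht as [k [<- Hk]]. apply in_seq in Hk.
      assert (in_chain m T (T k) = true) by (apply propb_true; exists k; split; [lia|auto]).
      rewrite H in Hf; discriminate.
  - intros t. rewrite in_app_iff, filter_In, in_map_iff. split.
    + intros Ht. destruct (in_chain m T t) eqn:E; [left|right; auto].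
      apply propb_true in E as [k [Hk ->]]. exists k. split; [auto|apply in_seq; lia].
    + intros [[k [<- Hk]]|[Ht _]]; [|auto]. apply in_seq in Hk. apply C1; lia.
Qed.

(* [D t p] stands for half the squared increment of the function of triangle [t]
   along the spoke [p], and [x t] for its value at the hub of the patch. *)
Lemma open_patch_poincare inc (l : list nat) (x H : nat -> R) (D : nat -> pt -> R) :
  NoDup l -> two_spokes inc l -> spokes_at_most_double inc l ->
  (forall t p, 0 <= D t p) ->
  (forall t p q, In t l -> inc t p -> inc t q -> p <> q -> D t p + D t q = H t) ->
  (forall t t' p, In t l -> In t' l -> t <> t' -> inc t p -> inc t' p ->
     (x t - x t') ^ 2 <= D t p + D t' p) ->
  (forall t p, In t l -> inc t p -> (forall t', In t' l -> inc t' p -> t' = t) ->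
     2 * x t ^ 2 <= D t p) ->
  (forall m T P, (1 <= m)%nat -> chain inc l m T P -> P 0%nat <> P m) ->
  rsum (fun t => x t ^ 2) l <= (2 * INR (length l) ^ 2 + 1) / 12 * rsum H l.
Proof.
  remember (length l) as N eqn:HN.
  assert (HN' : (length l <= N)%nat) by lia. clear HN. revert l HN'.
  induction N as [N IH] using (well_founded_induction Nat.lt_wf_0). intros l HN Hl H2 H3 HD HH Hsh Hun Hcyc.
  destruct (classic (l = nil)) as [->|Hne].
  { unfold rsum; cbn. lra. }
  (* A maximal chain is split off and the induction hypothesis handles the remaining triangles. Both
     parts may use the constant for [N], since it increases with the number of values. *)
  destruct (chain_maximal inc l H2 H3 Hne) as [m [T [P [Hm [C Hend]]]]].
  assert (Hl1 := chain_length _ _ _ _ _ C).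
  destruct Hend as [E|[E0 E1]]; [exfalso; exact (Hcyc m T P Hm C E)|].
  rewrite (rsum_chain _ _ _ _ _ _ Hl C), (rsum_chain _ _ _ _ _ H Hl C).
  set (l' := filter (fun t => negb (in_chain m T t)) l).
  assert (Hl' : forall t, In t l' <-> In t l /\ ~ exists k, (k < m)%nat /\ t = T k).
  { intros t. unfold l'. rewrite filter_In, negb_true_iff, <- not_true_iff_false.
    unfold in_chain. now rewrite propb_true. }
  destruct C as [C1 [C2 C3]].
  assert (Hlen : (length l' < N)%nat).
  { apply Nat.lt_le_trans with (length (T 0%nat :: l')); [cbn; lia|].
    apply Nat.le_trans with (length l); [|exact HN].
    apply NoDup_incl_length.
    - constructor; [|now apply NoDup_filter]. rewrite Hl'. intros [_ Hn]. apply Hn. exists 0%nat. split; [lia|auto].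
    - intros t [<-|Ht]; [apply C1; lia|]. now apply Hl' in Ht. }
  assert (HHn : forall t, In t l -> 0 <= H t).
  { intros t Ht. destruct (H2 t Ht) as [p [q [Hpq E]]].
    rewrite <- (HH t p q); auto; [|apply E; auto|apply E; auto].
    apply Rplus_le_le_0_compat; apply HD. }
  rewrite Rmult_plus_distr_l. apply Rplus_le_compat.
  - apply Rle_trans with ((2 * INR m ^ 2 + 1) / 12 * rsum (fun k => H (T k)) (seq 0 m)).
    (* Link [k] of the path is the spoke shared by [T k] and [T (S k)]. Regrouping the energies by
       spokes leaves one unpaired term at each end. *)
    + set (G := fun k => D (T k) (P (S k)) + D (T (S k)) (P (S k))).
      assert (E : rsum (fun k => H (T k)) (seq 0 m) =
                  D (T 0%nat) (P 0%nat) + rsum G (seq 0 (m - 1)) + D (T (m - 1)%nat) (P m)).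
      { rewrite (rsum_ext _ (fun k => D (T k) (P k) + D (T k) (P (S k)))).
        - unfold G. rewrite !rsum_plus.
          replace m with (S (m - 1)) at 1 2 by lia.
          rewrite rsum_seq_shift, rsum_seq_S. replace (S (m - 1)) with m by lia. ring.
        - intros k Hk. apply in_seq in Hk. destruct (C3 k) as [X1 [X2 X3]]; [lia|].
          symmetry; apply HH; auto. apply C1; lia. }
      (* At the unshared end spokes [x^2 <= D / 2]: the function vanishes halfway along them. *)
      rewrite E. apply path_poincare with (r := / 2); auto; try lra.
      * destruct (C3 0%nat) as [X1 _]; [lia|].
        assert (2 * x (T 0%nat) ^ 2 <= D (T 0%nat) (P 0%nat)); [|lra].
        apply Hun; auto; apply C1; lia.
      * destruct (C3 (m - 1)%nat) as [_ [X1 _]]; [lia|]. replace (S (m - 1)) with m in X1 by lia.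
        assert (2 * x (T (m - 1)%nat) ^ 2 <= D (T (m - 1)%nat) (P m)); [|lra].
        apply Hun; auto; apply C1; lia.
      * intros k Hk. destruct (C3 k) as [_ [X1 _]]; [lia|]. destruct (C3 (S k)) as [X2 _]; [lia|].
        apply Hsh; auto; try (apply C1; lia). intros X. apply C2 in X; lia.
    + apply Rmult_le_compat_r.
      * apply rsum_nonneg. intros k Hk. apply in_seq in Hk. apply HHn, C1; lia.
      * assert (INR m <= INR N) by (apply le_INR; lia). assert (HA := pos_INR m). nra.
  - apply Rle_trans with ((2 * INR (length l') ^ 2 + 1) / 12 * rsum H l').
    + apply (IH (length l')); auto.
      * now apply NoDup_filter.
      * intros t Ht. apply Hl' in Ht as [Ht _]. auto.
      * intros t1 t2 t3 p A1 A2 A3. apply Hl' in A1 as [A1 _]; apply Hl' in A2 as [A2 _];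
          apply Hl' in A3 as [A3 _]. apply H3; auto.
      * intros t p q Ht. apply Hl' in Ht as [Ht _]. auto.
      * intros t t' p Ht Ht'. apply Hl' in Ht as [Ht _]. apply Hl' in Ht' as [Ht' _]. auto.
      (* Removing the chain creates no new unshared spokes. If a chain triangle had the spoke [p] of
         a remaining triangle [t], then [p] would be an end of the chain, which belongs to one
         triangle only, or an inner spoke, which already belongs to two. *)
      * intros t p Ht Hp Hu. apply Hl' in Ht as [Ht Hnt]. apply Hun; auto.
        intros t' Ht' Hp'. destruct (classic (exists k, (k < m)%nat /\ t' = T k)) as [[k [Hk ->]]|Hn'].
        2: { apply Hu; auto. now apply Hl'. }
        exfalso. destruct (C3 k Hk) as [X1 [X2 X3]].
        assert (Hno : forall j, (j < m)%nat -> t <> T j) by (intros j Hj ->; apply Hnt; exists j; auto).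
        destruct (two_spokes_cases inc l (T k) (P k) (P (S k)) p) as [->| ->]; auto.
        -- destruct k as [|k].
           ++ apply (Hno 0%nat); [lia|]. now apply E0.
           ++ destruct (C3 k) as [Y1 [Y2 Y3]]; [lia|].
              destruct (H3 t (T k) (T (S k)) (P (S k))) as [X|[X|X]]; auto.
              ** apply C1; lia.
              ** now apply (Hno k); [lia|].
              ** now apply (Hno (S k)).
              ** apply C2 in X; lia.
        -- destruct (Nat.eq_dec (S k) m) as [Em|Em].
           ++ apply (Hno (m - 1)%nat); [lia|]. apply E1; auto. now rewrite <- Em.
           ++ destruct (C3 (S k)) as [Y1 [Y2 Y3]]; [lia|].
              destruct (H3 t (T k) (T (S k)) (P (S k))) as [X|[X|X]]; auto.
              ** apply C1; lia.
              ** now apply (Hno k).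
              ** now apply (Hno (S k)); [lia|].
              ** apply C2 in X; lia.
      * intros m' T' P' Hm' [C1' [C2' C3']]. apply (Hcyc m' T' P'); auto. split; [|split]; auto.
        intros k Hk. apply C1' in Hk. now apply Hl' in Hk.
    + apply Rmult_le_compat_r.
      * apply rsum_nonneg. intros t Ht. apply HHn. now apply Hl' in Ht.
      * assert (INR (length l') <= INR N) by (apply le_INR; lia). assert (HA := pos_INR (length l')). nra.
Qed.

Lemma closed_patch_poincare inc (l : list nat) (x H : nat -> R) (D : nat -> pt -> R) m T P :
  NoDup l ->
  (forall t p q, In t l -> inc t p -> inc t q -> p <> q -> D t p + D t q = H t) ->
  (forall t t' p, In t l -> In t' l -> inc t p -> inc t' p ->
     (x t - x t') ^ 2 <= D t p + D t' p) ->
  (1 <= m)%nat -> chain inc l m T P -> P 0%nat = P m ->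
  (forall t, In t l -> exists k, (k < m)%nat /\ t = T k) ->
  (exists t, In t l /\ x t <= 0) -> (exists t, In t l /\ 0 <= x t) ->
  rsum (fun t => x t ^ 2) l <= (2 * INR (length l) ^ 2 + 1) / 12 * rsum H l.
Proof.
  intros Hl HH Hsh Hm C Hc Hall [i [Hi Hxi]] [j [Hj Hxj]].
  assert (Hlen := chain_length _ _ _ _ _ C).
  rewrite (rsum_chain _ _ _ _ _ _ Hl C), (rsum_chain _ _ _ _ _ H Hl C).
  replace (filter (fun t => negb (in_chain m T t)) l) with (@nil nat).
  2: { symmetry. destruct (filter _ l) as [|t l'] eqn:E; [reflexivity|].
       assert (Ht : In t (filter (fun t => negb (in_chain m T t)) l)) by (rewrite E; now left).
       apply filter_In in Ht as [Ht Hn]. apply Hall in Ht.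
       apply propb_true in Ht. unfold in_chain in Hn. rewrite Ht in Hn; discriminate. }
  unfold rsum at 2 4; cbn [map fold_right]. rewrite !Rplus_0_r.
  destruct C as [C1 [C2 C3]].
  apply Rle_trans with ((2 * INR m ^ 2 + 1) / 12 * rsum (fun k => H (T k)) (seq 0 m)).
  (* Indices are reduced modulo [m] to obtain periodic sequences; [P 0 = P m] makes the spokes fit
     at the wrap-around. *)
  - set (T' := fun k => T (k mod m)%nat). set (P' := fun k => P (k mod m)%nat).
    set (G := fun k => D (T' k) (P' (S k)) + D (T' (S k)) (P' (S k))).
    assert (HTp : forall k, T' (k + m)%nat = T' k).
    { intros k. unfold T'. f_equal. replace (k + m)%nat with (k + 1 * m)%nat by lia. apply Nat.Div0.mod_add. }
    assert (HPp : forall k, P' (k + m)%nat = P' k).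
    { intros k. unfold P'. f_equal. replace (k + m)%nat with (k + 1 * m)%nat by lia. apply Nat.Div0.mod_add. }
    assert (HPS : forall k, P' (S k) = P (S (k mod m))%nat).
    { intros k. unfold P'. assert (Hk := Nat.mod_upper_bound k m ltac:(lia)).
      rewrite <- Nat.add_1_l, <- Nat.Div0.add_mod_idemp_r, Nat.add_1_l.
      destruct (Nat.eq_dec (S (k mod m)) m) as [E|E].
      - rewrite E, Nat.Div0.mod_same. exact Hc.
      - rewrite Nat.mod_small by lia. reflexivity. }
    assert (HT : forall k, In (T' k) l) by (intros k; apply C1, Nat.mod_upper_bound; lia).
    assert (HP : forall k, inc (T' k) (P' k) /\ inc (T' k) (P' (S k)) /\ P' k <> P' (S k)).
    { intros k. rewrite HPS. apply C3, Nat.mod_upper_bound; lia. }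
    assert (E : rsum (fun k => H (T k)) (seq 0 m) = rsum G (seq 0 m)).
    { unfold G. rewrite rsum_plus.
      (* The sum over links takes the first spoke of the next triangle; a cyclic shift by one brings
         it back to the triangle itself. *)
      assert (E := rsum_periodic (fun k => D (T' k) (P' k)) m 1). cbn [Nat.add] in E.
      rewrite E by (intros; cbn beta; now rewrite HTp, HPp). rewrite <- rsum_plus.
      apply rsum_ext. intros k Hk. apply in_seq in Hk.
      destruct (HP k) as [X1 [X2 X3]]. rewrite Rplus_comm, (HH (T' k)); auto.
      unfold T'. now rewrite Nat.mod_small by lia. }
    rewrite E, (rsum_ext _ (fun k => x (T' k) ^ 2)).
    2: { intros k Hk. apply in_seq in Hk. unfold T'. now rewrite Nat.mod_small by lia. }
    apply cycle_poincare with (x := fun k => x (T' k)); auto.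
    + intros k. unfold G. change (S (k + m)) with (S k + m)%nat. now rewrite !HTp, HPp.
    + intros k. apply Hsh; auto; apply HP.
    + destruct (Hall i Hi) as [k [Hk ->]]. exists k. split; [auto|]. unfold T'. now rewrite Nat.mod_small by lia.
    + destruct (Hall j Hj) as [k [Hk ->]]. exists k. split; [auto|]. unfold T'. now rewrite Nat.mod_small by lia.
  - apply Rmult_le_compat_r.
    + apply rsum_nonneg. intros k Hk. apply in_seq in Hk. destruct (C3 k) as [X1 [X2 X3]]; [lia|].
      assert (Ht : In (T k) l) by (apply C1; lia).
      rewrite <- (HH (T k) _ _ Ht X1 X2 X3).
      (* For two equal triangles [Hsh] says that [D] is nonnegative. *)
      assert (Y1 := Hsh _ _ _ Ht Ht X1 X1). assert (Y2 := Hsh _ _ _ Ht Ht X2 X2).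
      assert (Hq := pow2_ge_0 (x (T k) - x (T k))). lra.
    + assert (INR m <= INR (length l)) by (apply le_INR; lia). assert (HA := pos_INR m). nra.
Qed.

(** * Planar geometry of the triangulation *)

Ltac pt_unfold := unfold mid, padd, psub, pscal, det2, dot in *; cbn [fst snd] in *.
Ltac pt_ring := apply injective_projections; pt_unfold; ring.

Lemma dot_ge0 u : 0 <= dot u u.
Proof.
  unfold dot. assert (X := Rle_0_sqr (fst u)). assert (Y := Rle_0_sqr (snd u)).
  unfold Rsqr in *; lra.
Qed.

(** All six orders are listed, so that any vertex can serve as the hub and either of the other two
    can be named first. *)
Inductive corner : tri -> pt -> pt -> pt -> Prop :=
| corner_ABC a b c : corner (Tri a b c) a b c
| corner_ACB a b c : corner (Tri a b c) a c b
| corner_BAC a b c : corner (Tri a b c) b a c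
| corner_BCA a b c : corner (Tri a b c) b c a
| corner_CAB a b c : corner (Tri a b c) c a b
| corner_CBA a b c : corner (Tri a b c) c b a.

Definition comb (z p q : pt) (a b : R) : pt :=
  padd z (padd (pscal a (psub p z)) (pscal b (psub q z))).
(** Twice the signed area; its sign tells on which side of the line through [z] and [p] the point
    [q] lies. *)
Definition spread (z p q : pt) : R := det2 (psub p z) (psub q z).

Lemma corner_swap T z p q : corner T z p q -> corner T z q p.
Proof. destruct 1; constructor. Qed.

Lemma corner_vertex T z p q y :
  corner T z p q -> (is_vertex y T <-> y = z \/ y = p \/ y = q).
Proof. destruct 1; unfold is_vertex; cbn; tauto. Qed.

Lemma vertex_corner T z : is_vertex z T -> exists p q, corner T z p q.
Proof.
  destruct T as [a b c]; unfold is_vertex; cbn.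
  intros [->|[->| ->]]; do 2 eexists; constructor.
Qed.

Lemma corner_area T z p q : corner T z p q -> area T = Rabs (spread z p q) / 2.
Proof.
  assert (E : forall x y, x = y \/ x = - y -> Rabs x / 2 = Rabs y / 2).
  { intros x y [->| ->]; [|rewrite Rabs_Ropp]; reflexivity. }
  destruct 1; unfold area, spread; cbn [tA tB tC]; apply E;
    ((left; pt_unfold; ring) || (right; pt_unfold; ring)).
Qed.

Lemma corner_spread T z p q : 0 < area T -> corner T z p q -> spread z p q <> 0.
Proof.
  intros H C E. rewrite (corner_area _ _ _ _ C), E, Rabs_R0 in H. lra.
Qed.

Lemma spread_neq z p q : spread z p q <> 0 -> p <> z /\ q <> z /\ p <> q.
Proof.
  intros H; repeat split; intros ->; apply H; unfold spread; pt_unfold; ring.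
Qed.

Lemma corner_other T z p q p' :
  0 < area T -> corner T z p q -> is_vertex p' T -> p' <> z ->
  exists q', corner T z p' q'.
Proof.
  intros HT C Hp Hn. apply (corner_vertex _ _ _ _ p' C) in Hp.
  destruct Hp as [?|[->| ->]]; [contradiction|now exists q|exists p].
  now apply corner_swap.
Qed.

Lemma comb_inj z p q a b a' b' :
  spread z p q <> 0 -> comb z p q a b = comb z p q a' b' -> a = a' /\ b = b'.
Proof.
  intros H E.
  assert (E1 := Rminus_diag_eq _ _ (f_equal fst E)).
  assert (E2 := Rminus_diag_eq _ _ (f_equal snd E)).
  destruct z as [z1 z2], p as [p1 p2], q as [q1 q2].
  unfold comb, spread in *; pt_unfold.
  assert (Ha : ((p1 - z1) * (q2 - z2) - (p2 - z2) * (q1 - z1)) * (a - a') = 0).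
  { match type of E1 with ?x = 0 => match type of E2 with ?y = 0 =>
      transitivity ((q2 - z2) * x - (q1 - z1) * y); [ring|rewrite E1, E2; ring] end end. }
  assert (Hb : ((p1 - z1) * (q2 - z2) - (p2 - z2) * (q1 - z1)) * (b - b') = 0).
  { match type of E1 with ?x = 0 => match type of E2 with ?y = 0 =>
      transitivity ((p1 - z1) * y - (p2 - z2) * x); [ring|rewrite E1, E2; ring] end end. }
  apply Rmult_integral in Ha as [Ha|Ha]; [contradiction|].
  apply Rmult_integral in Hb as [Hb|Hb]; [contradiction|].
  split; lra.
Qed.

(** Cramer's rule in the basis [p - z], [q - z]. *)
Lemma vec_coord z p q u :
  spread z p q <> 0 ->
  u = padd (pscal (det2 u (psub q z) / spread z p q) (psub p z))
           (pscal (det2 (psub p z) u / spread z p q) (psub q z)).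
Proof.
  unfold spread; intros H. apply injective_projections; pt_unfold; field; exact H.
Qed.

(** Gathers the weights at three points and remembers that a nonzero weight comes from a member of
    [S]. With [S] the common vertices of two triangles, a point in the intersection thereby reveals
    which vertices are shared. *)
Lemma conv_comb (S : pt -> Prop) z p q x :
  (forall y, S y -> y = z \/ y = p \/ y = q) -> in_conv_pt S x ->
  exists a b, 0 <= a /\ 0 <= b /\ a + b <= 1 /\ x = comb z p q a b /\
    (a + b <> 1 -> S z) /\ (a <> 0 -> S p) /\ (b <> 0 -> S q).
Proof.
  intros HS [l [Hl [Hsum ->]]].
  assert (H : exists c a b, 0 <= c /\ 0 <= a /\ 0 <= b /\
    c + a + b = fold_right Rplus 0 (map fst l) /\
    (c <> 0 -> S z) /\ (a <> 0 -> S p) /\ (b <> 0 -> S q) /\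
    fold_right padd (0, 0) (map (fun wp => pscal (fst wp) (snd wp)) l) =
      padd (pscal c z) (padd (pscal a p) (pscal b q))).
  { clear Hsum. induction Hl as [|[w y] l [Hw Hy] Hl IH]; cbn [map fold_right fst snd] in *.
    - exists 0, 0, 0. repeat split; try lra; try tauto. pt_ring.
    - destruct IH as [c [a [b [Hc [Ha [Hb [E [Sc [Sa [Sb ->]]]]]]]]]].
      destruct (HS y Hy) as [->|[->| ->]].
      + exists (w + c), a, b. repeat split; auto; try lra. pt_ring.
      + exists c, (w + a), b. repeat split; auto; try lra. pt_ring.
      + exists c, a, (w + b). repeat split; auto; try lra. pt_ring. }
  destruct H as [c [a [b [Hc [Ha [Hb [E [Sc [Sa [Sb ->]]]]]]]]]].
  rewrite Hsum in E. exists a, b. repeat split; auto; try lra.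
  - unfold comb. replace c with (1 - a - b) by lra. pt_ring.
  - intros Hn. apply Sc. lra.
Qed.

Lemma comb_in_tri T z p q a b :
  corner T z p q -> 0 <= a -> 0 <= b -> a + b <= 1 -> in_tri T (comb z p q a b).
Proof.
  intros C Ha Hb Hab. unfold in_tri, in_conv_pt.
  exists ((1 - a - b, z) :: (a, p) :: (b, q) :: nil)%list. repeat split.
  - repeat apply Forall_cons; [..|apply Forall_nil]; cbn;
      (split; [lra|apply (corner_vertex _ _ _ _ _ C); auto]).
  - cbn. ring.
  - cbn [map fold_right fst snd]. unfold comb. pt_ring.
Qed.

Lemma in_tri_comb T z p q x :
  corner T z p q -> in_tri T x ->
  exists a b, 0 <= a /\ 0 <= b /\ a + b <= 1 /\ x = comb z p q a b.
Proof.
  intros C H. destruct (conv_comb _ z p q x (fun y => proj1 (corner_vertex _ _ _ _ y C)) H)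
    as [a [b [Ha [Hb [Hab [E _]]]]]].
  now exists a, b.
Qed.

(** Stands in for continuity: barycentric and cone coordinates are affine along a ray. *)
Lemma affine_pos_small a b : 0 < a -> exists e, 0 < e /\ forall s, 0 <= s <= e -> 0 < a + s * b.
Proof.
  intros Ha. exists (a / (2 * (1 + Rabs b))).
  assert (Hb := Rabs_pos b). split.
  - apply Rdiv_lt_0_compat; lra.
  - intros s [Hs1 Hs2].
    assert (Hs : s * (1 + Rabs b) <= a / 2).
    { apply Rmult_le_compat_r with (r := 1 + Rabs b) in Hs2; [|lra].
      replace (a / (2 * (1 + Rabs b)) * (1 + Rabs b)) with (a / 2) in Hs2 by (field; lra). exact Hs2. }
    assert (- Rabs b <= b) by (unfold Rabs; destruct Rcase_abs; lra).
    nra.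
Qed.

Lemma eventually_all {A} (l : list A) (Q : A -> R -> Prop) :
  (forall t, In t l -> exists e, 0 < e /\ forall s, 0 < s <= e -> Q t s) ->
  exists e, 0 < e /\ forall s, 0 < s <= e -> forall t, In t l -> Q t s.
Proof.
  induction l as [|t l IH]; intros H.
  - exists 1. split; [lra|]. intros s _ t [].
  - destruct IH as [e [He1 He2]]; [intros t' Ht'; apply H; now right|].
    destruct (H t) as [e' [He1' He2']]; [now left|].
    exists (Rmin e e'). split; [now apply Rmin_glb_lt|].
    intros s [Hs1 Hs2] t' [<-|Ht'].
    + apply He2'. split; [lra|]. eapply Rle_trans; [exact Hs2|apply Rmin_r].
    + apply He2; auto. split; [lra|]. eapply Rle_trans; [exact Hs2|apply Rmin_l].
Qed.

Lemma regular_area O tris i :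
  regular_triangulation O tris -> (i < length tris)%nat -> 0 < area (triT tris i).
Proof. intros [H _]; apply H. Qed.

(** All three barycentric weights of the point are positive, so every vertex of triangle [i] is
    shared by [j] if the two are distinct; regularity forbids equal vertex sets. *)
Lemma tri_interior_unique O tris i j z p q a b :
  regular_triangulation O tris -> (i < length tris)%nat -> (j < length tris)%nat ->
  corner (triT tris i) z p q -> 0 < a -> 0 < b -> a + b < 1 ->
  in_tri (triT tris j) (comb z p q a b) -> i = j.
Proof.
  intros Htri Hi Hj C Ha Hb Hab Hin. apply NNPP; intros Hne.
  assert (Ai := regular_area _ _ _ Htri Hi). assert (Aj := regular_area _ _ _ Htri Hj).
  destruct Htri as [_ [_ H3]]. destruct (H3 i j Hi Hj Hne) as [Hd Hx].
  assert (Hin' : in_tri (triT tris i) (comb z p q a b)) by (apply comb_in_tri; auto; lra).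
  assert (Hc := proj1 (Hx (comb z p q a b)) (conj Hin' Hin)).
  destruct (conv_comb _ z p q _ (fun y Hy => proj1 (corner_vertex _ _ _ _ y C) (proj1 Hy)) Hc)
    as [a' [b' [_ [_ [_ [E [Sz [Sp Sq]]]]]]]].
  assert (Hs := corner_spread _ _ _ _ Ai C).
  apply comb_inj in E as [<- <-]; [|exact Hs].
  destruct Sz as [_ Vz]; [lra|]. destruct Sp as [_ Vp]; [lra|]. destruct Sq as [_ Vq]; [lra|].
  apply spread_neq in Hs as [N1 [N2 N3]].
  apply Hd. intros y. rewrite (corner_vertex _ _ _ _ y C).
  destruct (vertex_corner _ _ Vz) as [p' [q' C']].
  apply (corner_vertex _ _ _ _ p C') in Vp. apply (corner_vertex _ _ _ _ q C') in Vq.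
  rewrite (corner_vertex _ _ _ _ y C').
  destruct Vp as [?|[->| ->]], Vq as [?|[->| ->]]; try contradiction; try tauto.
Qed.

(** If both triangles lie on the same side of the edge, a point moved slightly from its midpoint
    towards that side is interior to the first and still in the second. *)
Lemma edge_sides O tris i j z p q q' :
  regular_triangulation O tris -> (i < length tris)%nat -> (j < length tris)%nat ->
  corner (triT tris i) z p q -> corner (triT tris j) z p q' ->
  0 < spread z p q * spread z p q' -> i = j.
Proof.
  intros Htri Hi Hj Ci Cj Hs.
  assert (Hs' : spread z p q' <> 0) by (intros E; rewrite E in Hs; lra).
  set (al := det2 (psub q z) (psub q' z) / spread z p q').
  set (be := det2 (psub p z) (psub q z) / spread z p q').
  assert (Hbe : 0 < be).
  { unfold be. fold (spread z p q). replace (spread z p q / spread z p q') with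
      ((spread z p q * spread z p q') * / (spread z p q' * spread z p q')) by (field; exact Hs').
    apply Rmult_lt_0_compat; [exact Hs|]. apply Rinv_0_lt_compat.
    apply Rsqr_pos_lt in Hs'. exact Hs'. }
  destruct (affine_pos_small (/2) al) as [e1 [He1 Hp1]]; [lra|].
  destruct (affine_pos_small (/2) (- (al + be))) as [e2 [He2 Hp2]]; [lra|].
  set (d := Rmin (/4) (Rmin e1 e2)).
  assert (Hd : 0 < d) by (unfold d; repeat apply Rmin_glb_lt; lra).
  assert (Hd1 : d <= /4) by apply Rmin_l.
  assert (Hd2 : d <= e1) by (eapply Rle_trans; [apply Rmin_r|apply Rmin_l]).
  assert (Hd3 : d <= e2) by (eapply Rle_trans; [apply Rmin_r|apply Rmin_r]).
  specialize (Hp1 d ltac:(lra)). specialize (Hp2 d ltac:(lra)).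
  apply (tri_interior_unique O tris i j z p q (/2) d); auto; try lra.
  replace (comb z p q (/2) d) with (comb z p q' (/2 + d * al) (d * be)).
  - apply comb_in_tri; auto; try lra. apply Rmult_le_pos; lra.
  - assert (E := vec_coord z p q' (psub q z) Hs'). fold al be in E.
    unfold comb. rewrite E. pt_ring.
Qed.

Lemma edge_opposite O tris i j z p q q' :
  regular_triangulation O tris -> (i < length tris)%nat -> (j < length tris)%nat -> i <> j ->
  corner (triT tris i) z p q -> corner (triT tris j) z p q' ->
  spread z p q * spread z p q' < 0.
Proof.
  intros Htri Hi Hj Hne Ci Cj.
  assert (Si := corner_spread _ _ _ _ (regular_area _ _ _ Htri Hi) Ci).
  assert (Sj := corner_spread _ _ _ _ (regular_area _ _ _ Htri Hj) Cj).
  destruct (Rtotal_order (spread z p q * spread z p q') 0) as [H|[H|H]]; auto.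
  - apply Rmult_integral in H; tauto.
  - exfalso. apply Hne. eapply edge_sides; eauto.
Qed.

Definition patch (tris : list tri) (z : pt) : list nat :=
  filter (fun i => is_vertexb z (triT tris i)) (seq 0 (length tris)).
Definition spoke (tris : list tri) (z : pt) (t : nat) (p : pt) : Prop :=
  p <> z /\ is_vertex p (triT tris t).

Lemma is_vertexb_spec z T : is_vertexb z T = true <-> is_vertex z T.
Proof.
  unfold is_vertexb, is_vertex.
  destruct (pt_eq_dec z (tA T)), (pt_eq_dec z (tB T)), (pt_eq_dec z (tC T));
    split; intros; auto; try discriminate; tauto.
Qed.

Lemma in_patch tris z t :
  In t (patch tris z) <-> (t < length tris)%nat /\ is_vertex z (triT tris t).
Proof.
  unfold patch. rewrite filter_In, in_seq, is_vertexb_spec.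
  split; intros [H1 H2]; split; auto; lia.
Qed.

Lemma NoDup_patch tris z : NoDup (patch tris z).
Proof. apply NoDup_filter, seq_NoDup. Qed.

Lemma spoke_corner O tris z t p :
  regular_triangulation O tris -> In t (patch tris z) -> spoke tris z t p ->
  exists q, corner (triT tris t) z p q.
Proof.
  intros Htri Ht [Hn Hp]. apply in_patch in Ht as [Ht Hz].
  destruct (vertex_corner _ _ Hz) as [a [b C]].
  eapply corner_other; eauto. eapply regular_area; eauto.
Qed.

Lemma patch_two_spokes O tris z :
  regular_triangulation O tris -> two_spokes (spoke tris z) (patch tris z).
Proof.
  intros Htri t Ht. apply in_patch in Ht as [Ht Hz].
  destruct (vertex_corner _ _ Hz) as [p [q C]].
  assert (Hs := corner_spread _ _ _ _ (regular_area _ _ _ Htri Ht) C).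
  apply spread_neq in Hs as [N1 [N2 N3]].
  exists p, q. split; [exact N3|]. intros y. unfold spoke. rewrite (corner_vertex _ _ _ _ y C).
  split; [tauto|]. intros [->| ->]; auto.
Qed.

(** Three triangles on one edge would have spreads of pairwise opposite sign, but two of three
    nonzero reals have the same sign. *)
Lemma patch_at_most_double O tris z :
  regular_triangulation O tris -> spokes_at_most_double (spoke tris z) (patch tris z).
Proof.
  intros Htri t1 t2 t3 p H1 H2 H3 S1 S2 S3.
  destruct (spoke_corner _ _ _ _ _ Htri H1 S1) as [q1 C1].
  destruct (spoke_corner _ _ _ _ _ Htri H2 S2) as [q2 C2].
  destruct (spoke_corner _ _ _ _ _ Htri H3 S3) as [q3 C3].
  apply in_patch in H1 as [H1 _]; apply in_patch in H2 as [H2 _]; apply in_patch in H3 as [H3 _].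
  destruct (Nat.eq_dec t1 t2) as [|N1]; [auto|].
  destruct (Nat.eq_dec t1 t3) as [|N2]; [auto|].
  destruct (Nat.eq_dec t2 t3) as [|N3]; [auto|]. exfalso.
  assert (E1 := edge_opposite _ _ _ _ _ _ _ _ Htri H1 H2 N1 C1 C2).
  assert (E2 := edge_opposite _ _ _ _ _ _ _ _ Htri H1 H3 N2 C1 C3).
  assert (E3 := edge_opposite _ _ _ _ _ _ _ _ Htri H2 H3 N3 C2 C3).
  nra.
Qed.

(** * Cones at a vertex and the fan they form *)

Definition in_cone (z p q u : pt) : Prop :=
  exists a b, 0 <= a /\ 0 <= b /\ u = padd (pscal a (psub p z)) (pscal b (psub q z)).

Lemma in_cone_coord z p q u :
  spread z p q <> 0 ->
  (in_cone z p q u <-> 0 <= det2 u (psub q z) / spread z p q /\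
                      0 <= det2 (psub p z) u / spread z p q).
Proof.
  intros H. split.
  - intros [a [b [Ha [Hb ->]]]].
    replace (_ / _) with a by (unfold spread in *; pt_unfold; field; exact H).
    replace (det2 _ _ / _) with b by (unfold spread in *; pt_unfold; field; exact H).
    auto.
  - intros [Ha Hb]. do 2 eexists. split; [exact Ha|split; [exact Hb|]].
    now apply vec_coord.
Qed.

Lemma cone_tri T z p q u :
  corner T z p q -> in_cone z p q u ->
  exists e, 0 < e /\ forall s, 0 < s <= e -> in_tri T (padd z (pscal s u)).
Proof.
  intros C [a [b [Ha [Hb ->]]]].
  destruct (affine_pos_small 1 (- (a + b))) as [e [He H]]; [lra|].
  exists e. split; [exact He|]. intros s Hs. specialize (H s ltac:(lra)).
  replace (padd z _) with (comb z p q (s * a) (s * b)) by (unfold comb; pt_ring).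
  apply comb_in_tri; auto; try nra; apply Rmult_le_pos; lra.
Qed.

Lemma cone_complement_open z p q u w :
  spread z p q <> 0 -> ~ in_cone z p q u ->
  exists e, 0 < e /\ forall s, 0 <= s <= e -> ~ in_cone z p q (padd u (pscal s w)).
Proof.
  intros H Hu. rewrite in_cone_coord in Hu by exact H.
  assert (L1 : forall s, det2 (padd u (pscal s w)) (psub q z) / spread z p q =
     det2 u (psub q z) / spread z p q + s * (det2 w (psub q z) / spread z p q)).
  { intros s. unfold spread in *; pt_unfold; field; exact H. }
  assert (L2 : forall s, det2 (psub p z) (padd u (pscal s w)) / spread z p q =
     det2 (psub p z) u / spread z p q + s * (det2 (psub p z) w / spread z p q)).
  { intros s. unfold spread in *; pt_unfold; field; exact H. }
  apply not_and_or in Hu as [Hu|Hu]; apply Rnot_le_lt in Hu.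
  - destruct (affine_pos_small (- (det2 u (psub q z) / spread z p q))
        (- (det2 w (psub q z) / spread z p q))) as [e [He Hs]]; [lra|].
    exists e. split; [exact He|]. intros s Hse. specialize (Hs s Hse).
    rewrite in_cone_coord by exact H. rewrite L1. lra.
  - destruct (affine_pos_small (- (det2 (psub p z) u / spread z p q))
        (- (det2 (psub p z) w / spread z p q))) as [e [He Hs]]; [lra|].
    exists e. split; [exact He|]. intros s Hse. specialize (Hs s Hse).
    rewrite in_cone_coord by exact H. rewrite L2. lra.
Qed.

Definition in_fan (tris : list tri) (F : nat -> Prop) (z u : pt) : Prop :=
  exists t p q, F t /\ corner (triT tris t) z p q /\ in_cone z p q u.

Definition spokes_doubled (tris : list tri) (F : nat -> Prop) (z : pt) : Prop :=
  forall t p, F t -> spoke tris z t p -> exists t', F t' /\ t' <> t /\ spoke tris z t' p.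

(** The two triangles on the spoke lie on opposite sides of it, so any perturbation [w] points into
    the cone of one of them. *)
Lemma fan_spoke_open O tris F z t p q a w :
  regular_triangulation O tris -> (forall t, F t -> In t (patch tris z)) ->
  spokes_doubled tris F z -> F t -> corner (triT tris t) z p q -> 0 < a ->
  exists e, 0 < e /\ forall s, 0 <= s <= e ->
    in_fan tris F z (padd (pscal a (psub p z)) (pscal s w)).
Proof.
  intros Htri HF Hd Ft C Ha.
  destruct (proj1 (in_patch tris z t) (HF t Ft)) as [Ht Hz].
  assert (Hs := corner_spread _ _ _ _ (regular_area _ _ _ Htri Ht) C).
  assert (Hsp : spoke tris z t p).
  { apply spread_neq in Hs as [N1 _]. split; [exact N1|]. apply (corner_vertex _ _ _ _ _ C); auto. }
  destruct (Hd t p Ft Hsp) as [t' [Ft' [Hne Hsp']]].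
  destruct (spoke_corner _ _ _ _ _ Htri (HF t' Ft') Hsp') as [q' C'].
  destruct (proj1 (in_patch tris z t') (HF t' Ft')) as [Ht' _].
  assert (Hs' := corner_spread _ _ _ _ (regular_area _ _ _ Htri Ht') C').
  assert (Hop := edge_opposite _ _ _ _ _ _ _ _ Htri Ht Ht' (not_eq_sym Hne) C C').
  assert (K : forall r t0, F t0 -> corner (triT tris t0) z p r -> spread z p r <> 0 ->
     0 <= det2 (psub p z) w / spread z p r ->
     exists e, 0 < e /\ forall s, 0 <= s <= e ->
       in_fan tris F z (padd (pscal a (psub p z)) (pscal s w))).
  { intros r t0 F0 C0 S0 Hb.
    destruct (affine_pos_small a (det2 w (psub r z) / spread z p r) Ha) as [e [He Hp]].
    exists e. split; [exact He|]. intros s Hse. exists t0, p, r. repeat split; auto.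
    exists (a + s * (det2 w (psub r z) / spread z p r)), (s * (det2 (psub p z) w / spread z p r)).
    split; [left; now apply Hp|]. split; [apply Rmult_le_pos; lra|].
    rewrite (vec_coord z p r w S0) at 1. pt_ring. }
  destruct (Rle_dec 0 (det2 (psub p z) w / spread z p q)) as [Hb|Hb]; [now apply (K q t)|].
  apply (K q' t'); auto. apply Rnot_le_lt in Hb.
  (* The spreads have opposite signs, so a coordinate negative in the first triangle is positive in
     the second. *)
  replace (det2 (psub p z) w / spread z p q') with
    ((- (det2 (psub p z) w / spread z p q)) * (- (spread z p q * spread z p q')) *
       / (spread z p q' * spread z p q')) by (field; auto).
  left. repeat apply Rmult_lt_0_compat; try lra.
  apply Rinv_0_lt_compat. apply Rsqr_pos_lt in Hs'. exact Hs'.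
Qed.

Lemma fan_open O tris F z u w :
  regular_triangulation O tris -> (forall t, F t -> In t (patch tris z)) ->
  spokes_doubled tris F z -> in_fan tris F z u -> u <> (0, 0) ->
  exists e, 0 < e /\ forall s, 0 <= s <= e -> in_fan tris F z (padd u (pscal s w)).
Proof.
  intros Htri HF Hd [t [p [q [Ft [C [a [b [Ha [Hb ->]]]]]]]]] Hu.
  destruct (proj1 (in_patch tris z t) (HF t Ft)) as [Ht Hz].
  assert (Hs := corner_spread _ _ _ _ (regular_area _ _ _ Htri Ht) C).
  destruct Ha as [Ha|<-]; [destruct Hb as [Hb|<-]|destruct Hb as [Hb|<-]].
  - destruct (affine_pos_small a (det2 w (psub q z) / spread z p q) Ha) as [e [He Hp]].
    destruct (affine_pos_small b (det2 (psub p z) w / spread z p q) Hb) as [e' [He' Hp']].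
    exists (Rmin e e'). split; [now apply Rmin_glb_lt|]. intros s [Hs1 Hs2].
    exists t, p, q. repeat split; auto. do 2 eexists.
    split; [left; apply (Hp s); split; [exact Hs1|eapply Rle_trans; [exact Hs2|apply Rmin_l]]|].
    split; [left; apply (Hp' s); split; [exact Hs1|eapply Rle_trans; [exact Hs2|apply Rmin_r]]|].
    rewrite (vec_coord z p q w Hs) at 1. pt_ring.
  - destruct (fan_spoke_open O tris F z t p q a w) as [e [He H]]; auto.
    exists e. split; [exact He|]. intros s Hse.
    replace (padd (pscal a _) _) with (pscal a (psub p z)) by pt_ring. auto.
  - destruct (fan_spoke_open O tris F z t q p b w) as [e [He H]]; auto using corner_swap.
    exists e. split; [exact He|]. intros s Hse.
    replace (padd (pscal 0 _) _) with (pscal b (psub q z)) by pt_ring. auto.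
  - exfalso. apply Hu. pt_ring.
Qed.

(* The fan is closed, and open away from the origin; a segment from a direction in
   the fan to one outside, missing the origin, would contradict connectedness. *)
Lemma fan_full O tris F z u :
  regular_triangulation O tris -> (forall t, F t -> In t (patch tris z)) ->
  spokes_doubled tris F z -> (exists t, F t) -> u <> (0, 0) -> in_fan tris F z u.
Proof.
  intros Htri HF Hd [t0 F0] Hu. apply NNPP; intros Hn.
  (* The segment starts at a direction not parallel to [u], so that it misses the origin. One of two
     spokes of a triangle will do, since both cannot be parallel to [u]. *)
  assert (Hu0 : exists u0, in_fan tris F z u0 /\ det2 u0 u <> 0).
  { destruct (proj1 (in_patch tris z t0) (HF t0 F0)) as [Ht Hz].
    destruct (vertex_corner _ _ Hz) as [p [q C]].
    assert (Hs := corner_spread _ _ _ _ (regular_area _ _ _ Htri Ht) C).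
    apply NNPP; intros H.
    assert (Ep : det2 (psub p z) u = 0).
    { apply NNPP; intros X. apply H. exists (psub p z). split; [|exact X].
      exists t0, p, q. repeat split; auto. exists 1, 0. repeat split; try lra. pt_ring. }
    assert (Eq : det2 (psub q z) u = 0).
    { apply NNPP; intros X. apply H. exists (psub q z). split; [|exact X].
      exists t0, p, q. repeat split; auto. exists 0, 1. repeat split; try lra. pt_ring. }
    apply Hu. rewrite (vec_coord z p q u Hs), Ep.
    replace (det2 u (psub q z)) with (- det2 (psub q z) u) by (pt_unfold; ring).
    rewrite Eq. apply injective_projections; pt_unfold; field; exact Hs. }
  destruct Hu0 as [u0 [Fu0 Hdet]].
  set (w := psub u u0). set (f := fun s => padd u0 (pscal s w)).
  set (A := fun s => 0 <= s <= 1 /\ in_fan tris F z (f s)).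
  (* [tau] is the last parameter in the fan: it is attained because finitely many cones are closed,
     and openness would push it further unless [tau = 1]. *)
  destruct (completeness A) as [tau [Hub Hlub]].
  { exists 1. intros s [Hs _]. lra. }
  { exists 0. split; [lra|]. unfold f. replace (padd _ _) with u0 by pt_ring. exact Fu0. }
  assert (H0 : 0 <= tau).
  { apply Hub. split; [lra|]. unfold f. replace (padd _ _) with u0 by pt_ring. exact Fu0. }
  assert (H1 : tau <= 1) by (apply Hlub; intros s [Hs _]; lra).
  assert (Htau : in_fan tris F z (f tau)).
  { apply NNPP; intros Hx.
    destruct (eventually_all (patch tris z) (fun t s => ~ (F t /\
       exists p q, corner (triT tris t) z p q /\ in_cone z p q (f (tau - s)))))
      as [e [He Hev]].
    { intros t Ht. destruct (classic (F t)) as [Ft|Ft].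
      2: { exists 1. split; [lra|]. tauto. }
      destruct (proj1 (in_patch tris z t) Ht) as [Htl Hz].
      destruct (vertex_corner _ _ Hz) as [p [q C]].
      assert (Hs := corner_spread _ _ _ _ (regular_area _ _ _ Htri Htl) C).
      (* The fan quantifies over both orders of the spokes, but a triangle has only one cone at [z];
         it suffices to stay outside the one for [p] and [q]. *)
      assert (Hsym : forall p' q' y, corner (triT tris t) z p' q' -> in_cone z p' q' y -> in_cone z p q y).
      { intros p' q' y C' [a [b [Ha [Hb ->]]]].
        assert (Hs' := corner_spread _ _ _ _ (regular_area _ _ _ Htri Htl) C').
        apply spread_neq in Hs' as [N1 [N2 N3]].
        assert (Vp : is_vertex p' (triT tris t)) by (apply (corner_vertex _ _ _ _ _ C'); auto).
        assert (Vq : is_vertex q' (triT tris t)) by (apply (corner_vertex _ _ _ _ _ C'); auto).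
        apply (corner_vertex _ _ _ _ _ C) in Vp. apply (corner_vertex _ _ _ _ _ C) in Vq.
        destruct Vp as [?|[->| ->]], Vq as [?|[->| ->]]; try contradiction.
        - exists a, b; auto.
        - exists b, a; repeat split; auto. pt_ring. }
      assert (Hc : ~ in_cone z p q (f tau)) by (intros Hc; apply Hx; exists t, p, q; auto).
      destruct (cone_complement_open z p q (f tau) (pscal (-1) w) Hs Hc) as [e [He Hev]].
      exists e. split; [exact He|]. intros s Hse [_ [p' [q' [C' Hin]]]].
      apply (Hev s); [lra|]. apply (Hsym p' q'); auto.
      replace (padd _ _) with (f (tau - s)) by (unfold f; pt_ring). exact Hin. }
    assert (Hb : tau <= tau - e); [|lra].
    apply Hlub. intros s As. assert (Hst := Hub s As). destruct As as [Hs01 [t [p [q [Ft [C Hc]]]]]].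
    apply Rnot_lt_le; intros Hlt.
    destruct (Req_dec s tau) as [->|Hne].
    - apply Hx. exists t, p, q; auto.
    - apply (Hev (tau - s) ltac:(lra) t (HF t Ft)). split; [exact Ft|].
      exists p, q. split; [exact C|]. now replace (tau - (tau - s)) with s by ring. }
  destruct (Req_dec tau 1) as [E|E].
  { apply Hn. rewrite E in Htau. unfold f, w in Htau.
    replace (padd _ _) with u in Htau by pt_ring. exact Htau. }
  destruct (fan_open O tris F z (f tau) w) as [e [He Hev]]; auto.
  { intros Hf. apply Hdet.
    assert (Hd0 : det2 (f tau) w = 0) by (rewrite Hf; pt_unfold; ring).
    rewrite <- Hd0. unfold f, w. pt_unfold. ring. }
  assert (Hm : 0 < Rmin e (1 - tau)) by (apply Rmin_glb_lt; lra).
  assert (Hme := Rmin_l e (1 - tau)). assert (Hm1 := Rmin_r e (1 - tau)).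
  assert (Hc : tau + Rmin e (1 - tau) <= tau); [|lra].
  apply Hub. split; [lra|].
  replace (f _) with (padd (f tau) (pscal (Rmin e (1 - tau)) w)) by (unfold f; pt_ring).
  apply Hev; lra.
Qed.

(** In the chart at [x0] the domain lies below a graph with [g 0 <= 0], as [x0] is not in [O].
    Points near the vertical ray above [x0] stay above the graph by the Lipschitz bound. *)
Lemma lipschitz_exterior_ray O x0 :
  lipschitz_domain O -> bdry O x0 ->
  exists u h, u <> (0, 0) /\ 0 < h /\
    forall s, 0 < s < h -> ~ closure O (padd x0 (pscal s u)).
Proof.
  intros [_ [_ [_ HL]]] Hb.
  destruct (HL x0 Hb) as [th [r [h [L [g [Hr [Hh [Hg Hloc]]]]]]]].
  assert (Hcs := sin2_cos2 th). unfold Rsqr in Hcs.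
  assert (HL0 : 0 <= L).
  { specialize (Hg 1 0). replace (1 - 0) with 1 in Hg by ring. rewrite Rabs_R1 in Hg.
    assert (H := Rabs_pos (g 1 - g 0)). lra. }
  assert (Hg0 : g 0 <= 0).
  { destruct Hb as [_ Hb]. apply Rnot_lt_le; intros H. apply Hb.
    assert (Hx := Hloc x0). cbv zeta in Hx. unfold rot in Hx. pt_unfold.
    replace (cos th * (fst x0 - fst x0) - sin th * (snd x0 - snd x0)) with 0 in Hx by ring.
    replace (sin th * (fst x0 - fst x0) + cos th * (snd x0 - snd x0)) with 0 in Hx by ring.
    rewrite Rabs_R0 in Hx. apply Hx; auto. }
  (* This is the direction that [rot th] maps to [(0, 1)]. *)
  exists (sin th, cos th), h. split; [|split; [exact Hh|]].
  { intros E. injection E as E1 E2. rewrite E1, E2 in Hcs. lra. }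
  intros s [Hs0 Hsh] Hcl.
  (* The three terms keep the ball of radius [rho] within the chart horizontally, within it
     vertically, and above the graph, where [rho (1 + L) <= s / 2] is used. *)
  set (rho := Rmin r (Rmin (h - s) (s / (2 * (1 + L))))).
  assert (Hrho : 0 < rho).
  { unfold rho. repeat apply Rmin_glb_lt; try lra. apply Rdiv_lt_0_compat; lra. }
  assert (R1 : rho <= r) by apply Rmin_l.
  assert (R2 : rho <= h - s) by (eapply Rle_trans; [apply Rmin_r|apply Rmin_l]).
  assert (R3 : rho * (1 + L) <= s / 2).
  { assert (H : rho <= s / (2 * (1 + L))) by (eapply Rle_trans; [apply Rmin_r|apply Rmin_r]).
    apply Rmult_le_compat_r with (r := 1 + L) in H; [|lra].
    replace (s / (2 * (1 + L)) * (1 + L)) with (s / 2) in H by (field; lra). exact H. }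
  destruct (Hcl rho Hrho) as [y [Oy By]].
  set (d := psub y (padd x0 (pscal s (sin th, cos th)))).
  assert (Hd : dot d d < rho * rho).
  { unfold ball, Defs.dist, pnorm in By.
    fold d in By.
    assert (Hdd : 0 <= dot d d) by apply dot_ge0.
    rewrite <- (sqrt_sqrt (dot d d)) by exact Hdd.
    assert (Hq := sqrt_pos (dot d d)). now apply Rmult_le_0_lt_compat. }
  specialize (Hloc y). cbv zeta in Hloc.
  set (Y := rot th (psub y x0)) in *.
  assert (HY1 : fst Y = cos th * fst d - sin th * snd d).
  { unfold Y, rot, d. pt_unfold. ring. }
  assert (HY2 : snd Y = s + (sin th * fst d + cos th * snd d)).
  { unfold Y, rot, d. pt_unfold.
    transitivity (sin th * (fst y - fst x0) + cos th * (snd y - snd x0)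
       + s * (1 - (sin th * sin th + cos th * cos th))); [rewrite Hcs; ring|ring]. }
  set (A := cos th * fst d - sin th * snd d) in *.
  set (B := sin th * fst d + cos th * snd d) in *.
  assert (HAB : A * A + B * B = dot d d).
  { unfold A, B, dot.
    transitivity ((sin th * sin th + cos th * cos th) * (fst d * fst d + snd d * snd d)); [ring|].
    rewrite Hcs; ring. }
  assert (HA : Rabs A < rho).
  { apply Rabs_def1; nra. }
  assert (HB : Rabs B < rho).
  { apply Rabs_def1; nra. }
  apply Rabs_def2 in HB as [HB1 HB2].
  rewrite HY1, HY2 in Hloc.
  destruct (Hloc ltac:(lra) ltac:(apply Rabs_def1; nra)) as [Hl _].
  specialize (Hl Oy).
  specialize (Hg A 0). rewrite Rminus_0_r in Hg.
  assert (HgA : g A - g 0 <= L * Rabs A) by (eapply Rle_trans; [apply RRle_abs|exact Hg]).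
  assert (L * Rabs A <= L * rho) by (apply Rmult_le_compat_l; lra).
  nra.
Qed.

Lemma patch_tri_closure O tris i x :
  regular_triangulation O tris -> (i < length tris)%nat -> in_tri (triT tris i) x -> closure O x.
Proof. intros [_ [H _]] Hi Hx. apply H. now exists i. Qed.

(** A fan without ends covers every direction, including that of an exterior ray at a boundary
    point, whereas its triangles lie in the closure of [O]. *)
Lemma doubled_spokes_interior O tris F z :
  lipschitz_domain O -> regular_triangulation O tris ->
  (forall t, F t -> In t (patch tris z)) ->
  spokes_doubled tris F z -> (exists t, F t) -> ~ bdry O z.
Proof.
  intros HO Htri HF Hd He Hb.
  destruct (lipschitz_exterior_ray O z HO Hb) as [u [h [Hu [Hh Hray]]]].
  destruct (fan_full O tris F z u Htri HF Hd He Hu) as [t [p [q [Ft [C Hc]]]]].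
  destruct (cone_tri _ _ _ _ _ C Hc) as [e [He' Hs]].
  assert (Hm : 0 < Rmin e (h / 2)) by (apply Rmin_glb_lt; lra).
  assert (Hml := Rmin_l e (h / 2)). assert (Hmr := Rmin_r e (h / 2)).
  apply (Hray (Rmin e (h / 2))); [lra|].
  apply (patch_tri_closure O tris t _ Htri).
  { apply HF in Ft. now apply in_patch in Ft. }
  apply Hs; lra.
Qed.

(** The direction [u] points into the interior of [t]. Some triangle of [F] covers it, hence
    contains interior points of [t] and must be [t]. *)
Lemma doubled_spokes_all O tris F z t :
  regular_triangulation O tris -> (forall t, F t -> In t (patch tris z)) ->
  spokes_doubled tris F z -> (exists t, F t) -> In t (patch tris z) -> F t.
Proof.
  intros Htri HF Hd He Ht. apply in_patch in Ht as [Ht Hz].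
  destruct (vertex_corner _ _ Hz) as [p [q C]].
  assert (Hsp := corner_spread _ _ _ _ (regular_area _ _ _ Htri Ht) C).
  set (u := padd (psub p z) (psub q z)).
  assert (Hu : u <> (0, 0)).
  { intros E. apply Hsp. unfold spread.
    replace (det2 (psub p z) (psub q z)) with (det2 (psub p z) u) by (unfold u; pt_unfold; ring).
    rewrite E. pt_unfold; ring. }
  destruct (fan_full O tris F z u Htri HF Hd He Hu) as [t' [p' [q' [Ft' [C' Hc]]]]].
  destruct (cone_tri _ _ _ _ _ C' Hc) as [e [He' Hs]].
  assert (Hm : 0 < Rmin e (/ 4)) by (apply Rmin_glb_lt; lra).
  assert (Hml := Rmin_l e (/ 4)). assert (Hmr := Rmin_r e (/ 4)).
  replace t with t'; [exact Ft'|]. symmetry.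
  apply (tri_interior_unique O tris t t' z p q (Rmin e (/ 4)) (Rmin e (/ 4))); auto; try lra.
  - apply HF in Ft'. now apply in_patch in Ft'.
  - replace (comb _ _ _ _ _) with (padd z (pscal (Rmin e (/ 4)) u)) by (unfold comb, u; pt_ring).
    apply Hs; lra.
Qed.

(** The triangles occupy both sides of the edge, so a ray from its midpoint starts inside one of
    them and cannot be exterior. *)
Lemma shared_edge_not_boundary O tris z i j p :
  lipschitz_domain O -> regular_triangulation O tris ->
  In i (patch tris z) -> In j (patch tris z) -> i <> j ->
  spoke tris z i p -> spoke tris z j p -> ~ boundary_edge O z p.
Proof.
  intros HO Htri Hi Hj Hne Si Sj Hbd.
  destruct (spoke_corner _ _ _ _ _ Htri Hi Si) as [q C].
  destruct (spoke_corner _ _ _ _ _ Htri Hj Sj) as [q' C'].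
  apply in_patch in Hi as [Hi _]; apply in_patch in Hj as [Hj _].
  assert (Hop := edge_opposite _ _ _ _ _ _ _ _ Htri Hi Hj Hne C C').
  set (m := padd z (pscal (/ 2) (psub p z))).
  assert (Hm : bdry O m) by (apply Hbd; exists (/ 2); split; [lra|reflexivity]).
  destruct (lipschitz_exterior_ray O m HO Hm) as [u [h [Hu [Hh Hray]]]].
  assert (K : forall r t, (t < length tris)%nat -> corner (triT tris t) z p r ->
     spread z p r <> 0 -> 0 <= det2 (psub p z) u / spread z p r -> False).
  { intros r t Ht C0 S0 Hb.
    set (a := det2 u (psub r z) / spread z p r). set (b := det2 (psub p z) u / spread z p r) in *.
    destruct (affine_pos_small (/ 2) a) as [e1 [He1 H1]]; [lra|].
    destruct (affine_pos_small (/ 2) (- (a + b))) as [e2 [He2 H2]]; [lra|].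
    set (s := Rmin (h / 2) (Rmin e1 e2)).
    assert (Hs : 0 < s) by (unfold s; repeat apply Rmin_glb_lt; lra).
    assert (Hs1 : s <= h / 2) by apply Rmin_l.
    assert (Hs2 : s <= e1) by (eapply Rle_trans; [apply Rmin_r|apply Rmin_l]).
    assert (Hs3 : s <= e2) by (eapply Rle_trans; [apply Rmin_r|apply Rmin_r]).
    specialize (H1 s ltac:(lra)). specialize (H2 s ltac:(lra)).
    apply (Hray s); [lra|]. apply (patch_tri_closure O tris t); auto.
    replace (padd m _) with (comb z p r (/ 2 + s * a) (s * b)).
    - apply comb_in_tri; auto; try lra. apply Rmult_le_pos; lra.
    - assert (E := vec_coord z p r u S0). fold a b in E. rewrite E. unfold comb, m. pt_ring. }
  assert (S1 : spread z p q <> 0) by (intros E; rewrite E in Hop; lra).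
  assert (S2 : spread z p q' <> 0) by (intros E; rewrite E in Hop; lra).
  destruct (Rle_dec 0 (det2 (psub p z) u / spread z p q)) as [Hb|Hb]; [now apply (K q i)|].
  apply (K q' j); auto. apply Rnot_le_lt in Hb.
  replace (det2 (psub p z) u / spread z p q') with
    ((- (det2 (psub p z) u / spread z p q)) * (- (spread z p q * spread z p q')) *
       / (spread z p q' * spread z p q')) by (field; auto).
  left. repeat apply Rmult_lt_0_compat; try lra.
  apply Rinv_0_lt_compat. apply Rsqr_pos_lt in S2. exact S2.
Qed.

Lemma tri_complement_open T x w :
  0 < area T -> ~ in_tri T x ->
  exists e, 0 < e /\ forall s, 0 < s <= e -> ~ in_tri T (padd x (pscal s w)).
Proof.
  intros HT Hx. destruct T as [z p q].
  assert (C : corner (Tri z p q) z p q) by constructor.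
  assert (Hs := corner_spread _ _ _ _ HT C).
  set (ca := fun y => det2 y (psub q z) / spread z p q).
  set (cb := fun y => det2 (psub p z) y / spread z p q).
  assert (Hin : forall y, in_tri (Tri z p q) y <->
     0 <= ca (psub y z) /\ 0 <= cb (psub y z) /\ 0 <= 1 - (ca (psub y z) + cb (psub y z))).
  { intros y. split.
    - intros Hy. destruct (in_tri_comb _ _ _ _ _ C Hy) as [a [b [Ha [Hb [Hab ->]]]]].
      replace (ca _) with a by (unfold ca, comb, spread in *; pt_unfold; field; exact Hs).
      replace (cb _) with b by (unfold cb, comb, spread in *; pt_unfold; field; exact Hs).
      repeat split; lra.
    - intros [Ha [Hb Hab]].
      replace y with (comb z p q (ca (psub y z)) (cb (psub y z))).
      + apply comb_in_tri; auto; lra.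
      + assert (E := vec_coord z p q (psub y z) Hs). fold (ca (psub y z)) (cb (psub y z)) in E.
        unfold comb. rewrite <- E. pt_ring. }
  assert (La : forall s, ca (psub (padd x (pscal s w)) z) = ca (psub x z) + s * ca w)
    by (intros s; unfold ca, spread in *; pt_unfold; field; exact Hs).
  assert (Lb : forall s, cb (psub (padd x (pscal s w)) z) = cb (psub x z) + s * cb w)
    by (intros s; unfold cb, spread in *; pt_unfold; field; exact Hs).
  assert (K : exists k l, k < 0 /\ forall s, in_tri (Tri z p q) (padd x (pscal s w)) -> 0 <= k + s * l).
  { rewrite Hin in Hx.
    destruct (Rle_dec 0 (ca (psub x z))) as [Xa|Xa];
      [destruct (Rle_dec 0 (cb (psub x z))) as [Xb|Xb]|].
    - exists (1 - (ca (psub x z) + cb (psub x z))), (- (ca w + cb w)). split; [lra|].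
      intros s Hy. rewrite Hin, La, Lb in Hy. lra.
    - exists (cb (psub x z)), (cb w). split; [lra|]. intros s Hy. rewrite Hin, La, Lb in Hy. lra.
    - exists (ca (psub x z)), (ca w). split; [lra|]. intros s Hy. rewrite Hin, La, Lb in Hy. lra. }
  destruct K as [k [l [Hk K]]].
  destruct (affine_pos_small (- k) (- l)) as [e [He H]]; [lra|].
  exists e. split; [exact He|]. intros s Hse Hy. apply K in Hy. specialize (H s ltac:(lra)). lra.
Qed.

Lemma open_small_step (O : pt -> Prop) x w :
  Defs.open_set O -> O x -> exists e, 0 < e /\ forall s, 0 <= s <= e -> O (padd x (pscal s w)).
Proof.
  intros HO Ox. destruct (HO x Ox) as [r [Hr Hb]].
  destruct (affine_pos_small r (- pnorm w) Hr) as [e [He Hs]].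
  exists e. split; [exact He|]. intros s Hse. specialize (Hs s Hse).
  apply Hb. unfold ball, Defs.dist, pnorm in *.
  replace (dot (psub (padd x (pscal s w)) x) _) with (s * s * dot w w) by (pt_unfold; ring).
  rewrite sqrt_mult_alt by nra. rewrite sqrt_square by lra. lra.
Qed.

(** If a point of the edge were in [O], one could step across the edge and stay in [O]; no triangle
    would cover the new point. *)
Lemma single_edge_boundary O tris z i p :
  lipschitz_domain O -> regular_triangulation O tris ->
  In i (patch tris z) -> spoke tris z i p ->
  (forall j, In j (patch tris z) -> spoke tris z j p -> j = i) -> boundary_edge O z p.
Proof.
  intros HO Htri Hi Si Huniq x [t [Ht ->]].
  destruct (spoke_corner _ _ _ _ _ Htri Hi Si) as [q C].
  apply in_patch in Hi as [Hi Hz].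
  assert (Hs := corner_spread _ _ _ _ (regular_area _ _ _ Htri Hi) C).
  split.
  { apply (patch_tri_closure O tris i); auto.
    replace (padd _ _) with (comb z p q t 0) by (unfold comb; pt_ring).
    apply comb_in_tri; auto; lra. }
  intros Ox. destruct HO as [HOo _].
  (* The point is first moved off the endpoints of the edge, where other triangles may meet triangle
     [i]. *)
  assert (Hx' : exists t', 0 < t' < 1 /\ O (padd z (pscal t' (psub p z)))).
  { destruct (open_small_step O _ (pscal (/ 2 - t) (psub p z)) HOo Ox) as [e [He H]].
    assert (Hm : 0 < Rmin e (/ 2)) by (apply Rmin_glb_lt; lra).
    assert (Hml := Rmin_l e (/ 2)). assert (Hmr := Rmin_r e (/ 2)).
    exists (t + Rmin e (/ 2) * (/ 2 - t)). split; [nra|].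
    replace (padd _ _) with (padd (padd z (pscal t (psub p z)))
      (pscal (Rmin e (/ 2)) (pscal (/ 2 - t) (psub p z)))) by pt_ring.
    apply H; lra. }
  clear t Ht Ox. destruct Hx' as [t [Ht Ox]].
  set (x := padd z (pscal t (psub p z))) in *.
  (* Along [w] the coordinate of [q] becomes negative, so triangle [i] is left at once; any other
     triangle containing [x] would share both [z] and [p]. *)
  set (w := pscal (-1) (psub q z)).
  assert (Ex : x = comb z p q t 0) by (unfold x, comb; pt_ring).
  destruct (open_small_step O x w HOo Ox) as [e [He Hin]].
  destruct (eventually_all (seq 0 (length tris))
     (fun j s => ~ in_tri (triT tris j) (padd x (pscal s w)))) as [e' [He' Hout]].
  { intros j Hj. apply in_seq in Hj. assert (Hj' : (j < length tris)%nat) by lia.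
    destruct (Nat.eq_dec j i) as [->|Hne].
    - exists 1. split; [lra|]. intros s Hs1 Hy.
      destruct (in_tri_comb _ _ _ _ _ C Hy) as [a [b [Ha [Hb [_ E]]]]].
      replace (padd _ _) with (comb z p q t (- s)) in E by (unfold comb, x, w; pt_ring).
      apply comb_inj in E as [_ E]; [lra|exact Hs].
    - apply tri_complement_open; [eapply regular_area; eauto|].
      intros Hx. destruct Htri as [_ [_ H3]]. destruct (H3 i j Hi Hj' (not_eq_sym Hne)) as [_ H].
      assert (Hxi : in_tri (triT tris i) x) by (rewrite Ex; apply comb_in_tri; auto; lra).
      assert (Hc := proj1 (H x) (conj Hxi Hx)).
      destruct (conv_comb _ z p q _ (fun y Hy => proj1 (corner_vertex _ _ _ _ y C) (proj1 Hy)) Hc)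
        as [a [b [_ [_ [_ [E [Sz [Sp _]]]]]]]].
      rewrite Ex in E. apply comb_inj in E as [<- <-]; [|exact Hs].
      destruct Sz as [_ Vz]; [lra|]. destruct Sp as [_ Vp]; [lra|].
      apply Hne, Huniq; [now apply in_patch|]. split; [apply Si|exact Vp]. }
  assert (Hm : 0 < Rmin e e') by now apply Rmin_glb_lt.
  assert (Hml := Rmin_l e e'). assert (Hmr := Rmin_r e e').
  assert (Oy := Hin (Rmin e e') ltac:(lra)).
  assert (Hcl : closure O (padd x (pscal (Rmin e e') w))).
  { intros r Hr. exists (padd x (pscal (Rmin e e') w)). split; [exact Oy|].
    unfold ball, Defs.dist, pnorm. replace (dot _ _) with 0 by (pt_unfold; ring). now rewrite sqrt_0. }
  destruct Htri as [_ [Hcov _]]. apply Hcov in Hcl as [j [Hj Hy]].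
  apply (Hout (Rmin e e') ltac:(lra) j); [apply in_seq; lia|exact Hy].
Qed.

(** * Integrals and constants *)

Lemma rsum_flat_map {A B} (f : B -> R) (h : A -> list B) l :
  rsum f (flat_map h l) = rsum (fun a => rsum f (h a)) l.
Proof.
  induction l as [|a l IH]; [reflexivity|].
  cbn [flat_map]. rewrite rsum_app, IH. reflexivity.
Qed.

Lemma affine_mid g p q : affine g -> g (mid p q) = (g p + g q) / 2.
Proof. intros [a [b [c H]]]. rewrite !H. pt_unfold. field. Qed.

Lemma affine_centroid g T : affine g -> g (centroid T) = (g (tA T) + g (tB T) + g (tC T)) / 3.
Proof. intros [a [b [c H]]]. rewrite !H. unfold centroid. pt_unfold. field. Qed.

Lemma area_red S S' : In S' (red_refine S) -> area S' = area S / 4.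
Proof.
  destruct S as [a b c]. unfold red_refine, area; cbn [tA tB tC In].
  set (D := det2 (psub b a) (psub c a)).
  intros [<-|[<-|[<-|[<-|[]]]]]; cbn [tA tB tC];
    match goal with |- Rabs ?x / 2 = _ =>
      replace x with (D * / 4) by (unfold D; pt_unfold; field) end;
    rewrite Rabs_mult, (Rabs_pos_eq (/ 4)) by lra; field.
Qed.

(** The quadratic form of the mass matrix of a triangle: the exact integral of [g^2] for affine
    [g]. *)
Definition quad_mass (g : pt -> R) (S : tri) : R :=
  area S / 12 * (g (tA S) ^ 2 + g (tB S) ^ 2 + g (tC S) ^ 2
                 + (g (tA S) + g (tB S) + g (tC S)) ^ 2).
Definition oscillation (g : pt -> R) (S : tri) : R :=
  area S * ((g (tA S) - g (tB S)) ^ 2 + (g (tB S) - g (tC S)) ^ 2 + (g (tC S) - g (tA S)) ^ 2).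

Lemma quad_mass_red g S : affine g -> rsum (quad_mass g) (red_refine S) = quad_mass g S.
Proof.
  intros Hg. rewrite (rsum_ext _ (fun S' => area S / 4 / 12 * (g (tA S') ^ 2 + g (tB S') ^ 2 + g (tC S') ^ 2
                 + (g (tA S') + g (tB S') + g (tC S')) ^ 2))).
  - unfold rsum, red_refine, quad_mass; cbn [map fold_right tA tB tC].
    rewrite !affine_mid by exact Hg. field.
  - intros S' HS. unfold quad_mass. now rewrite (area_red _ _ HS).
Qed.

(** Each of the four subtriangles has a quarter of the area and halved edge differences. *)
Lemma oscillation_red g S : affine g -> rsum (oscillation g) (red_refine S) = / 4 * oscillation g S.
Proof.
  intros Hg. rewrite (rsum_ext _ (fun S' => area S / 4 *
    ((g (tA S') - g (tB S')) ^ 2 + (g (tB S') - g (tC S')) ^ 2 + (g (tC S') - g (tA S')) ^ 2))).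
  - unfold rsum, red_refine, oscillation; cbn [map fold_right tA tB tC].
    rewrite !affine_mid by exact Hg. field.
  - intros S' HS. unfold oscillation. now rewrite (area_red _ _ HS).
Qed.

Lemma area_red_sum S : rsum area (red_refine S) = area S.
Proof.
  rewrite (rsum_ext _ (fun _ => area S / 4)) by (intros; now apply area_red).
  unfold rsum, red_refine; cbn. field.
Qed.

Lemma rsum_refine f c T k :
  (forall S, rsum f (red_refine S) = c * f S) -> rsum f (refine_k k T) = c ^ k * f T.
Proof.
  intros H; induction k as [|k IH]; [unfold rsum; cbn; ring|].
  cbn [refine_k]. rewrite rsum_flat_map, (rsum_ext _ (fun S => c * f S)), rsum_scal, IH by auto.
  cbn; ring.
Qed.

Lemma in_tri_convex T x y t : in_tri T x -> in_tri T y -> 0 <= t <= 1 ->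
  in_tri T (padd (pscal (1 - t) x) (pscal t y)).
Proof.
  destruct T as [z p q]. intros Hx Hy Ht.
  assert (C : corner (Tri z p q) z p q) by constructor.
  destruct (in_tri_comb _ _ _ _ _ C Hx) as [a [b [Ha [Hb [Hab ->]]]]].
  destruct (in_tri_comb _ _ _ _ _ C Hy) as [a' [b' [Ha' [Hb' [Hab' ->]]]]].
  replace (padd _ _) with (comb z p q ((1 - t) * a + t * a') ((1 - t) * b + t * b'))
    by (unfold comb; pt_ring).
  apply comb_in_tri; auto; nra.
Qed.

Lemma vertex_in_tri T z : is_vertex z T -> in_tri T z.
Proof.
  intros Hz. destruct (vertex_corner _ _ Hz) as [p [q C]].
  replace z with (comb z p q 0 0) by (unfold comb; pt_ring). apply comb_in_tri; auto; lra.
Qed.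

Lemma mid_in_tri T x y : in_tri T x -> in_tri T y -> in_tri T (mid x y).
Proof.
  intros Hx Hy. replace (mid x y) with (padd (pscal (1 - / 2) x) (pscal (/ 2) y)).
  - apply in_tri_convex; auto; lra.
  - apply injective_projections; pt_unfold; field.
Qed.

Lemma refine_in_tri T k S :
  In S (refine_k k T) -> in_tri T (tA S) /\ in_tri T (tB S) /\ in_tri T (tC S).
Proof.
  revert S; induction k as [|k IH]; cbn [refine_k]; intros S HS.
  - destruct HS as [<-|[]]. repeat split; apply vertex_in_tri; unfold is_vertex; auto.
  - apply in_flat_map in HS as [S0 [H0 HS]]. apply IH in H0 as [Ha [Hb Hc]].
    destruct HS as [<-|[<-|[<-|[<-|[]]]]]; cbn [tA tB tC]; auto using mid_in_tri.
Qed.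

Lemma centroid_in_tri T k S : In S (refine_k k T) -> in_tri T (centroid S).
Proof.
  intros HS. apply refine_in_tri in HS as [Ha [Hb Hc]].
  replace (centroid S) with
    (padd (pscal (1 - / 3) (mid (tA S) (tB S))) (pscal (/ 3) (tC S))).
  - apply in_tri_convex; [now apply mid_in_tri|exact Hc|lra].
  - apply injective_projections; unfold centroid; pt_unfold; field.
Qed.

Lemma tri_integral_eq T f I : Un_cv (riemann_sum T f) I -> tri_integral T f = I.
Proof.
  intros H. unfold tri_integral. eapply UL_sequence; [|exact H].
  apply epsilon_spec. now exists I.
Qed.

Lemma tri_integral_const T f c :
  (forall x, f x = c) -> tri_integral T f = area T * c.
Proof.
  intros H. apply tri_integral_eq. intros e He. exists 0%nat. intros k _.
  replace (riemann_sum T f k) with (area T * c); [now rewrite R_dist_eq|].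
  symmetry. transitivity (rsum (fun S => c * area S) (refine_k k T)).
  - apply rsum_ext. intros S _. rewrite H. ring.
  - rewrite rsum_scal, rsum_refine with (c := 1); [rewrite pow1; ring|].
    intros S. rewrite area_red_sum; ring.
Qed.

(* On each cell the centroid rule misses the exact integral of the square by 1/36 of
   the oscillation, and refinement divides the total oscillation by 4. *)
Lemma tri_integral_affine_sq T f g :
  affine g -> (forall x, in_tri T x -> f x = g x ^ 2) -> tri_integral T f = quad_mass g T.
Proof.
  intros Hg Hf. apply tri_integral_eq.
  assert (E : forall k, riemann_sum T f k = quad_mass g T - (/ 4) ^ k * (oscillation g T / 36)).
  { intros k. transitivity (rsum (fun S => quad_mass g S + - / 36 * oscillation g S) (refine_k k T)).
    - apply rsum_ext. intros S HS. rewrite Hf by (eapply centroid_in_tri; eauto).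
      rewrite affine_centroid by exact Hg. unfold quad_mass, oscillation. field.
    - rewrite rsum_plus, rsum_scal.
      rewrite (rsum_refine _ 1) by (intros S; rewrite quad_mass_red by exact Hg; ring).
      rewrite (rsum_refine _ (/ 4)) by (intros S; now apply oscillation_red).
      rewrite pow1. field. }
  intros e He.
  set (V := oscillation g T / 36) in *.
  destruct (pow_lt_1_zero (/ 4)) with (y := e / (1 + Rabs V)) as [N HN].
  - rewrite Rabs_pos_eq; lra.
  - apply Rdiv_lt_0_compat; [exact He|]. assert (H := Rabs_pos V); lra.
  - exists N. intros k Hk. specialize (HN k Hk). rewrite E. unfold R_dist.
    replace (quad_mass g T - (/ 4) ^ k * V - quad_mass g T) with (- ((/ 4) ^ k * V)) by ring.
    rewrite Rabs_Ropp, Rabs_mult. assert (H := Rabs_pos V).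
    apply Rmult_lt_compat_r with (r := 1 + Rabs V) in HN; [|lra].
    replace (e / (1 + Rabs V) * (1 + Rabs V)) with e in HN by (field; lra).
    assert (H' := Rabs_pos ((/ 4) ^ k)). nra.
Qed.

Lemma d1_affine f a b c x : (forall x, f x = a + b * fst x + c * snd x) -> Defs.d1 f x = b.
Proof.
  intros H. unfold Defs.d1.
  assert (D : derivable_pt_lim (fun t => f (t, snd x)) (fst x) b).
  { intros e He. exists (mkposreal 1 Rlt_0_1). intros h Hh _. rewrite !H; cbn [fst snd].
    replace (_ - b) with 0 by (field; exact Hh). now rewrite Rabs_R0. }
  eapply uniqueness_limite; [|exact D]. apply epsilon_spec. now exists b.
Qed.

Lemma d2_affine f a b c x : (forall x, f x = a + b * fst x + c * snd x) -> Defs.d2 f x = c.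
Proof.
  intros H. unfold Defs.d2.
  assert (D : derivable_pt_lim (fun t => f (fst x, t)) (snd x) c).
  { intros e He. exists (mkposreal 1 Rlt_0_1). intros h Hh _. rewrite !H; cbn [fst snd].
    replace (_ - c) with 0 by (field; exact Hh). now rewrite Rabs_R0. }
  eapply uniqueness_limite; [|exact D]. apply epsilon_spec. now exists c.
Qed.

(** With [al] the angle and [n] the product of the side lengths, the dot product is [n cos al] and
    the absolute spread is [n sin al]. Monotonicity of the cotangent then reads
    [sin (al - w) >= 0]. *)
Lemma angle_cot a b c w :
  spread a b c <> 0 -> 0 < w -> w <= angle a b c ->
  dot (psub b a) (psub c a) <= Rabs (spread a b c) * cot w.
Proof.
  unfold spread, angle. set (u := psub b a). set (y := psub c a).
  intros HD Hw Ha.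
  set (n := pnorm u * pnorm y) in *. set (X := dot u y) in *. set (D := det2 u y) in *.
  assert (HD2 : 0 < D * D) by (apply Rsqr_pos_lt in HD; exact HD).
  assert (Hn0 : 0 <= n) by (apply Rmult_le_pos; apply sqrt_pos).
  assert (Hn2 : n * n = X * X + D * D).
  { transitivity ((pnorm u * pnorm u) * (pnorm y * pnorm y)); [unfold n; ring|].
    unfold pnorm. rewrite !sqrt_sqrt by apply dot_ge0. unfold X, D. pt_unfold. ring. }
  assert (Hn : 0 < n).
  { destruct Hn0 as [|<-]; [assumption|]. exfalso. assert (H := Rle_0_sqr X). unfold Rsqr in H. lra. }
  assert (HXn : -1 <= X / n <= 1).
  { assert (E : X / n * n = X) by (field; lra).
    assert (HX : Rabs X <= Rabs n) by (apply Rsqr_le_abs_0; unfold Rsqr; lra).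
    rewrite (Rabs_pos_eq n) in HX by lra.
    assert (Y1 := Rle_abs X). assert (Y2 := Rle_abs (- X)). rewrite Rabs_Ropp in Y2.
    split; apply Rmult_le_reg_r with n; lra. }
  set (al := acos (X / n)) in *.
  assert (Hal := acos_bound (X / n)). fold al in Hal.
  assert (Hcos : n * cos al = X) by (unfold al; rewrite cos_acos by exact HXn; field; lra).
  assert (Hsin0 : 0 <= sin al) by (apply sin_ge_0; lra).
  assert (Hsin : n * sin al = Rabs D).
  { apply Rsqr_inj; [apply Rmult_le_pos; lra|apply Rabs_pos|].
    rewrite <- Rsqr_abs. unfold Rsqr. assert (E := sin2_cos2 al). unfold Rsqr in E.
    transitivity (n * n * (sin al * sin al + cos al * cos al) - (n * cos al) * (n * cos al)); [ring|].
    rewrite E, Hcos, Hn2. ring. }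
  assert (Halpi : al < PI).
  { destruct (Rle_lt_or_eq_dec al PI) as [H|H]; [lra|exact H|]. exfalso.
    rewrite H, sin_PI, Rmult_0_r in Hsin. symmetry in Hsin.
    apply (Rabs_no_R0 D); [exact HD|exact Hsin]. }
  assert (Hsw : 0 < sin w) by (apply sin_gt_0; lra).
  unfold cot.
  apply Rmult_le_reg_r with (sin w); [exact Hsw|].
  replace (Rabs D * (cos w / sin w) * sin w) with (Rabs D * cos w) by (field; lra).
  rewrite <- Hsin, <- Hcos.
  assert (Hs : 0 <= sin (al - w)) by (apply sin_ge_0; lra). rewrite sin_minus in Hs.
  assert (0 <= n * (sin al * cos w - cos al * sin w)) by (apply Rmult_le_pos; lra). lra.
Qed.

(** Eliminating [d1] leaves a binary form with diagonal [P + Q], [P + R0] and off-diagonal [P],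
    whose determinant is [P Q + Q R0 + R0 P]. *)
Lemma psd_on_sum_zero P Q R0 d1 d2 d3 :
  0 <= P + Q + R0 -> 0 <= P * Q + Q * R0 + R0 * P -> d1 + d2 + d3 = 0 ->
  0 <= P * d1 ^ 2 + Q * d2 ^ 2 + R0 * d3 ^ 2.
Proof.
  intros HS HD Hd. replace d1 with (- (d2 + d3)) by lra. clear d1 Hd.
  assert (HPQ : 0 <= P + Q).
  { apply Rnot_lt_le; intros H. assert (Hq := pow2_ge_0 (P - Q)). nra. }
  destruct HPQ as [HPQ|HPQ].
  - apply Rmult_le_reg_l with (P + Q); [exact HPQ|]. rewrite Rmult_0_r.
    assert (Hq := pow2_ge_0 ((P + Q) * d2 + P * d3)).
    assert (H : 0 <= (P * Q + Q * R0 + R0 * P) * d3 ^ 2) by (apply Rmult_le_pos; [exact HD|apply pow2_ge_0]).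
    lra.
  - assert (Hq := pow2_ge_0 P). assert (P = 0) by nra. assert (Q = 0) by lra. subst P Q.
    assert (H := pow2_ge_0 d3). nra.
Qed.

(** Divided by the squared spread, the first part is the identity for the cotangents of the three
    angles. Twice [p + q + r] is the sum of the squared sides. *)
Lemma corner_dots_sum a b c :
  let p := dot (psub b a) (psub c a) in
  let q := dot (psub c b) (psub a b) in
  let r := dot (psub a c) (psub b c) in
  p * q + q * r + r * p = spread a b c ^ 2 /\ 0 <= p + q + r.
Proof.
  cbv zeta. split; [unfold spread; pt_unfold; ring|].
  assert (H1 := dot_ge0 (psub b a)). assert (H2 := dot_ge0 (psub c b)). assert (H3 := dot_ge0 (psub a c)).
  pt_unfold. lra.
Qed.

Lemma edge_differences_le T w f :
  0 < area T -> 0 < w -> min_angle_ge T w -> affine f ->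
  (f (tA T) - f (tB T)) ^ 2 + (f (tB T) - f (tC T)) ^ 2 + (f (tC T) - f (tA T)) ^ 2
    <= 6 * cot w * tri_integral T (grad_sq f) /\ 0 <= cot w.
Proof.
  intros HT Hw [W1 [W2 W3]] [a0 [g1 [g2 Hf]]].
  rewrite (tri_integral_const T (grad_sq f) (g1 ^ 2 + g2 ^ 2)).
  2: { intros x. unfold grad_sq. now rewrite (d1_affine f a0 g1 g2), (d2_affine f a0 g1 g2). }
  destruct T as [a b c]; cbn [tA tB tC] in *.
  assert (Ca : corner (Tri a b c) a b c) by constructor.
  assert (Cb : corner (Tri a b c) b c a) by constructor.
  assert (Cc : corner (Tri a b c) c a b) by constructor.
  assert (Sa := corner_spread _ _ _ _ HT Ca). assert (Sb := corner_spread _ _ _ _ HT Cb).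
  assert (Sc := corner_spread _ _ _ _ HT Cc).
  assert (A1 := angle_cot a b c w Sa Hw W1). assert (A2 := angle_cot b c a w Sb Hw W2).
  assert (A3 := angle_cot c a b w Sc Hw W3).
  destruct (corner_dots_sum a b c) as [Hpqr Hsum].
  assert (E2 : spread b c a = spread a b c) by (unfold spread; pt_unfold; ring).
  assert (E3 : spread c a b = spread a b c) by (unfold spread; pt_unfold; ring).
  rewrite E2 in A2. rewrite E3 in A3.
  rewrite (corner_area _ _ _ _ Ca).
  (* The cotangent formula for the Dirichlet energy, cleared of denominators. *)
  assert (Hgrad : spread a b c ^ 2 * (g1 ^ 2 + g2 ^ 2) =
     dot (psub b a) (psub c a) * (f b - f c) ^ 2 + dot (psub c b) (psub a b) * (f c - f a) ^ 2
     + dot (psub a c) (psub b c) * (f a - f b) ^ 2).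
  { rewrite !Hf. unfold spread. pt_unfold. ring. }
  rewrite <- (pow2_abs (spread a b c)) in Hpqr, Hgrad.
  assert (HD := Rabs_pos_lt _ Sa).
  set (D := Rabs (spread a b c)) in *. set (k := cot w) in *.
  set (p := dot (psub b a) (psub c a)) in *. set (q := dot (psub c b) (psub a b)) in *.
  set (r := dot (psub a c) (psub b c)) in *.
  clearbody D k p q r.
  assert (Hsq : 3 * D ^ 2 <= (p + q + r) ^ 2).
  { rewrite <- Hpqr. assert (X := pow2_ge_0 (p - q)). assert (Y := pow2_ge_0 (q - r)).
    assert (Z := pow2_ge_0 (r - p)). lra. }
  assert (HDD : 0 < D ^ 2) by (apply pow_lt; exact HD).
  assert (Hs : 0 < p + q + r) by (destruct Hsum as [|E]; [assumption|rewrite <- E in Hsq; lra]).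
  assert (Hk : 0 < D * k) by lra.
  assert (Hk0 : 0 <= k) by (apply Rnot_lt_le; intros X; nra).
  split; [|exact Hk0].
  apply Rmult_le_reg_l with (D * D); [nra|].
  (* By the cotangent formula, [D] times the claim is nonnegativity of this form; the three
     differences sum to zero. *)
  assert (H := psd_on_sum_zero (3 * k * p - D) (3 * k * q - D) (3 * k * r - D)
                 (f b - f c) (f c - f a) (f a - f b)).
  assert (H' : 0 <= (3 * k * p - D) * (f b - f c) ^ 2 + (3 * k * q - D) * (f c - f a) ^ 2
                    + (3 * k * r - D) * (f a - f b) ^ 2).
  { apply H; [| |ring].
    - apply Rmult_le_reg_l with D; [exact HD|]. rewrite Rmult_0_r.
      assert (X : 0 <= (3 * (D * k) - (p + q + r)) * (p + q + r)) by (apply Rmult_le_pos; lra).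
      nra.
    (* The determinant is three times the sum of pairwise products of the nonnegative gaps
       [D k - p], [D k - q], [D k - r], modulo the cotangent identity. *)
    - assert (X1 : 0 <= (D * k - p) * (D * k - q)) by (apply Rmult_le_pos; lra).
      assert (X2 : 0 <= (D * k - q) * (D * k - r)) by (apply Rmult_le_pos; lra).
      assert (X3 : 0 <= (D * k - r) * (D * k - p)) by (apply Rmult_le_pos; lra).
      replace (_ + _) with (3 * ((D * k - p) * (D * k - q) + (D * k - q) * (D * k - r)
        + (D * k - r) * (D * k - p)) + (9 * k ^ 2 - 3) * (p * q + q * r + r * p - D ^ 2)) by ring.
      rewrite Hpqr. lra. }
  assert (X : D * (D * ((f a - f b) ^ 2 + (f b - f c) ^ 2 + (f c - f a) ^ 2)) <=
              D * (3 * k * (D ^ 2 * (g1 ^ 2 + g2 ^ 2)))).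
  { apply Rmult_le_compat_l; [lra|]. rewrite Hgrad. lra. }
  lra.
Qed.

(** Weitzenboeck's inequality between the area and the sum of squared sides, each of which is at
    most the squared diameter. *)
Lemma area_le_diam T : area T <= sqrt 3 / 4 * diam T ^ 2.
Proof.
  destruct T as [a b c]. rewrite (corner_area (Tri a b c) a b c) by constructor.
  set (h := diam (Tri a b c)).
  assert (K : forall u, pnorm u <= h -> dot u u <= h ^ 2).
  { intros u Hu. rewrite <- (sqrt_sqrt (dot u u)) by apply dot_ge0.
    fold (pnorm u). assert (X : 0 <= pnorm u) by apply sqrt_pos. nra. }
  assert (H1 : dot (psub a b) (psub a b) <= h ^ 2) by (apply K, Rmax_l).
  assert (H2 : dot (psub b c) (psub b c) <= h ^ 2)
    by (apply K; eapply Rle_trans; [apply Rmax_l|apply Rmax_r]).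
  assert (H3 : dot (psub c a) (psub c a) <= h ^ 2)
    by (apply K; eapply Rle_trans; [apply Rmax_r|apply Rmax_r]).
  destruct (corner_dots_sum a b c) as [Hpqr Hsum].
  rewrite <- (pow2_abs (spread a b c)) in Hpqr.
  assert (HD := Rabs_pos (spread a b c)). set (D := Rabs (spread a b c)) in *.
  assert (Hh : 2 * (dot (psub b a) (psub c a) + dot (psub c b) (psub a b) + dot (psub a c) (psub b c))
            <= 3 * h ^ 2).
  { apply Rle_trans with (dot (psub a b) (psub a b) + dot (psub b c) (psub b c) + dot (psub c a) (psub c a)); [|lra].
    right. pt_unfold. ring. }
  set (p := dot (psub b a) (psub c a)) in *. set (q := dot (psub c b) (psub a b)) in *.
  set (r := dot (psub a c) (psub b c)) in *.
  assert (Hsq : 3 * D ^ 2 <= (p + q + r) ^ 2).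
  { rewrite <- Hpqr. assert (X := pow2_ge_0 (p - q)). assert (Y := pow2_ge_0 (q - r)).
    assert (Z := pow2_ge_0 (r - p)). lra. }
  assert (H3s : sqrt 3 * sqrt 3 = 3) by (apply sqrt_sqrt; lra).
  assert (H3p := sqrt_pos 3).
  assert (X : sqrt 3 * D <= p + q + r).
  { apply Rsqr_incr_0; [|apply Rmult_le_pos; lra|lra]. unfold Rsqr.
    replace (sqrt 3 * D * (sqrt 3 * D)) with ((sqrt 3 * sqrt 3) * D ^ 2) by ring. rewrite H3s. lra. }
  assert (Y : sqrt 3 * (sqrt 3 * D) <= sqrt 3 * (3 / 2 * h ^ 2)) by (apply Rmult_le_compat_l; lra).
  replace (sqrt 3 * (sqrt 3 * D)) with (sqrt 3 * sqrt 3 * D) in Y by ring. rewrite H3s in Y. lra.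
Qed.

(** The cubic Taylor bound already gives [sin (3.2 / 6) > 1 / 2 = sin (PI / 6)]. *)
Lemma PI_upper : PI <= 3.2.
Proof.
  apply Rnot_lt_le; intros H.
  assert (Hs : sin (3.2 / 6) < sin (PI / 6)).
  { apply sin_increasing_1; assert (H4 := PI_4); lra. }
  rewrite sin_PI6 in Hs.
  assert (Hb := proj1 (pre_sin_bound (3.2 / 6) 0 ltac:(lra) ltac:(lra))).
  unfold sin_approx, sum_f_R0, sin_term in Hb. cbn in Hb. lra.
Qed.

Lemma cos_lower x : 1 - x ^ 2 / 2 <= cos x.
Proof.
  assert (E : cos x = 1 - 2 * (sin (x / 2)) ^ 2).
  { replace x with (2 * (x / 2)) at 1 by field. rewrite cos_2a_sin. ring. }
  assert (H : sin (x / 2) ^ 2 <= (x / 2) ^ 2).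
  { assert (K : forall y, 0 <= y -> sin y ^ 2 <= y ^ 2).
    { intros y Hy. destruct Hy as [Hy|<-]; [|rewrite sin_0; lra].
      assert (Hu := sin_lt_x y Hy).
      destruct (Rle_dec y 1) as [H1|H1].
      - assert (0 <= sin y) by (apply sin_ge_0; assert (H3 := PI2_3_2); lra). nra.
      - assert (B := SIN_bound y). nra. }
    destruct (Rle_dec 0 (x / 2)) as [Hx|Hx]; [now apply K|].
    replace (x / 2) with (- (- (x / 2))) by ring. rewrite sin_neg.
    specialize (K (- (x / 2)) ltac:(lra)). lra. }
  rewrite E. lra.
Qed.

(* The path constant is [~ M^2 / 6], below the [~ 2 M^2 / PI^2] of the right-hand side. *)
Lemma path_constant_le M :
  (1 <= M)%nat -> 0 < 1 - cos (PI / INR M) /\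
  (2 * INR M ^ 2 + 1) / 12 <= / (1 - cos (PI / INR M)).
Proof.
  intros HM. assert (HP := PI_RGT_0).
  assert (H1 : 1 <= INR M) by (apply (le_INR 1); exact HM).
  assert (Hx : 0 < PI / INR M) by (apply Rdiv_lt_0_compat; lra).
  assert (Hx' : PI / INR M <= PI).
  { apply Rmult_le_reg_r with (INR M); [lra|]. replace (PI / INR M * INR M) with PI by (field; lra). nra. }
  assert (Hpos : 0 < 1 - cos (PI / INR M)).
  { assert (H := cos_decreasing_1 0 (PI / INR M)). rewrite cos_0 in H. lra. }
  split; [exact Hpos|].
  apply Rmult_le_reg_r with (1 - cos (PI / INR M)); [exact Hpos|].
  rewrite Rinv_l by lra.
  (* For [M = 1] the quadratic bound of the cosine is too weak, but [cos PI = -1] is exact. *)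
  destruct (Nat.eq_dec M 1) as [->|HM1].
  - cbn [INR]. replace (PI / 1) with PI by field. rewrite cos_PI. lra.
  - assert (H2 : 2 <= INR M) by (apply (le_INR 2); lia).
    assert (Hc := cos_lower (PI / INR M)).
    assert (Hu := PI_upper).
    apply Rle_trans with ((2 * INR M ^ 2 + 1) / 12 * ((PI / INR M) ^ 2 / 2)).
    + apply Rmult_le_compat_l; [nra|lra].
    + replace ((2 * INR M ^ 2 + 1) / 12 * ((PI / INR M) ^ 2 / 2)) with
        (PI ^ 2 * ((2 * INR M ^ 2 + 1) / (24 * INR M ^ 2))) by (field; lra).
      (* The quotient decreases in [M]; [9 / 96] is its value at [M = 2]. *)
      assert (Hr : (2 * INR M ^ 2 + 1) / (24 * INR M ^ 2) <= 9 / 96).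
      { apply Rmult_le_reg_r with (24 * INR M ^ 2); [nra|].
        replace (_ / _ * _) with (2 * INR M ^ 2 + 1) by (field; lra). nra. }
      apply Rle_trans with (PI ^ 2 * (9 / 96)); [apply Rmult_le_compat_l; [apply pow2_ge_0|exact Hr]|].
      nra.
Qed.

(** * Vertex patches *)

Lemma chain_cycle_doubled O tris z m T P :
  regular_triangulation O tris -> (1 <= m)%nat ->
  chain (spoke tris z) (patch tris z) m T P -> P 0%nat = P m ->
  spokes_doubled tris (fun t => exists k, (k < m)%nat /\ t = T k) z.
Proof.
  intros Htri Hm [C1 [C2 C3]] E t p [k [Hk ->]] Hp.
  assert (H2 := patch_two_spokes O tris z Htri).
  (* With at least two triangles in the cycle, the predecessor and the successor of a triangle
     differ from it. *)
  assert (Hm1 : m <> 1%nat).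
  { intros ->. destruct (C3 0%nat) as [_ [_ N]]; [lia|]. contradiction. }
  destruct (C3 k Hk) as [X1 [X2 X3]].
  destruct (two_spokes_cases _ _ (T k) (P k) (P (S k)) p H2) as [->| ->]; auto.
  - destruct k as [|k].
    + exists (T (m - 1)%nat). destruct (C3 (m - 1)%nat) as [_ [Y _]]; [lia|].
      replace (S (m - 1)) with m in Y by lia. rewrite E. repeat split; try apply Y.
      * exists (m - 1)%nat. split; [lia|reflexivity].
      * intros X. apply C2 in X; lia.
    + exists (T k). destruct (C3 k) as [_ [Y _]]; [lia|]. repeat split; try apply Y.
      * exists k. split; [lia|reflexivity].
      * intros X. apply C2 in X; lia.
  - destruct (Nat.eq_dec (S k) m) as [Em|Em].
    + exists (T 0%nat). destruct (C3 0%nat) as [Y _]; [lia|]. rewrite Em, <- E.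
      repeat split; try apply Y.
      * exists 0%nat. split; [lia|reflexivity].
      * intros X. apply C2 in X; lia.
    + exists (T (S k)). destruct (C3 (S k)) as [Y _]; [lia|]. repeat split; try apply Y.
      * exists (S k). split; [lia|reflexivity].
      * intros X. apply C2 in X; lia.
Qed.

Lemma in_conv_lower_bound (S : R -> Prop) y c :
  in_conv_R S y -> (forall s, S s -> c <= s) -> c <= y.
Proof.
  intros [l [Hl [Hs ->]]] Hc.
  assert (H : c * fold_right Rplus 0 (map fst l) <=
              fold_right Rplus 0 (map (fun wp => fst wp * snd wp) l)).
  { clear Hs. induction Hl as [|[w s] l [Hw Hs] Hl IH]; cbn in *; [lra|].
    assert (w * c <= w * s) by (apply Rmult_le_compat_l; auto). lra. }
  rewrite Hs in H. lra.
Qed.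

Lemma in_conv_upper_bound (S : R -> Prop) y c :
  in_conv_R S y -> (forall s, S s -> s <= c) -> y <= c.
Proof.
  intros [l [Hl [Hs ->]]] Hc.
  assert (H : fold_right Rplus 0 (map (fun wp => fst wp * snd wp) l) <=
              c * fold_right Rplus 0 (map fst l)).
  { clear Hs. induction Hl as [|[w s] l [Hw Hs] Hl IH]; cbn in *; [lra|].
    assert (w * s <= w * c) by (apply Rmult_le_compat_l; auto). lra. }
  rewrite Hs in H. lra.
Qed.

(* Half the squared increments from [z] to the three vertices; the one from [z] to
   itself vanishes, so no case distinction on the position of [z] is needed. *)
Definition spoke_energy (f : pt -> R) (z : pt) (T : tri) : R :=
  / 2 * ((f z - f (tA T)) ^ 2 + (f z - f (tB T)) ^ 2 + (f z - f (tC T)) ^ 2).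

Lemma spoke_energy_ge0 f z T : 0 <= spoke_energy f z T.
Proof.
  unfold spoke_energy. assert (X := pow2_ge_0 (f z - f (tA T))).
  assert (Y := pow2_ge_0 (f z - f (tB T))). assert (Z := pow2_ge_0 (f z - f (tC T))). lra.
Qed.

Lemma spoke_energy_corner f z p q T :
  corner T z p q -> spoke_energy f z T = / 2 * (f z - f p) ^ 2 + / 2 * (f z - f q) ^ 2.
Proof. destruct 1; unfold spoke_energy; cbn [tA tB tC]; ring. Qed.

Lemma node_estimate O tris v w z :
  lipschitz_domain O -> regular_triangulation O tris -> CR10 O tris v ->
  (bdry O z -> w = 0) ->
  (O z -> in_conv_R (fun y => exists i, (i < length tris)%nat /\
                     is_vertex z (triT tris i) /\ y = v i z) w) ->
  rsum (fun t => (v t z - w) ^ 2) (patch tris z) <=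
    (2 * INR (length (patch tris z)) ^ 2 + 1) / 12 *
    rsum (fun t => spoke_energy (v t) z (triT tris t)) (patch tris z).
Proof.
  intros HO Htri [Haff [Hcont Hzero]] Hbd Hint.
  destruct (classic (patch tris z = nil)) as [->|Hne]; [unfold rsum; cbn; lra|].
  assert (H2 := patch_two_spokes O tris z Htri).
  assert (H3 := patch_at_most_double O tris z Htri).
  assert (Hedge : forall t p, In t (patch tris z) -> spoke tris z t p -> is_edge z p (triT tris t)).
  { intros t p Ht [Hn Hp]. apply in_patch in Ht as [_ Hz]. split; auto. }
  assert (Hen : forall t p q, In t (patch tris z) -> spoke tris z t p -> spoke tris z t q -> p <> q ->
     / 2 * (v t z - v t p) ^ 2 + / 2 * (v t z - v t q) ^ 2 = spoke_energy (v t) z (triT tris t)).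
  { intros t p q Ht Hp Hq Hpq. destruct (spoke_corner _ _ _ _ _ Htri Ht Hp) as [r C].
    destruct Hq as [Hqz Hq]. apply (corner_vertex _ _ _ _ _ C) in Hq as [?|[?| ->]]; try congruence.
    symmetry; now apply spoke_energy_corner. }
  assert (Hshared : forall t t' p, In t (patch tris z) -> In t' (patch tris z) -> t <> t' ->
     spoke tris z t p -> spoke tris z t' p ->
     ((v t z - w) - (v t' z - w)) ^ 2 <= / 2 * (v t z - v t p) ^ 2 + / 2 * (v t' z - v t' p) ^ 2).
  { intros t t' p Ht Ht' Hn Hp Hp'.
    assert (Hb := shared_edge_not_boundary _ _ _ _ _ _ HO Htri Ht Ht' Hn Hp Hp').
    assert (Et := Hedge _ _ Ht Hp). assert (Et' := Hedge _ _ Ht' Hp').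
    apply in_patch in Ht as [Ht _]; apply in_patch in Ht' as [Ht' _].
    assert (Em := Hcont t t' z p Ht Ht' Et Et' Hb).
    rewrite !affine_mid in Em by auto.
    (* Equality at the midpoint turns the jump at [z] into half the difference of the two
       increments; its square is at most half the sum of their squares. *)
    replace (v t z - w - (v t' z - w)) with (/ 2 * ((v t z - v t p) - (v t' z - v t' p))) by lra.
    assert (Hq := pow2_ge_0 ((v t z - v t p) + (v t' z - v t' p))). lra. }
  assert (Hzclo : closure O z).
  { destruct (patch tris z) as [|t l] eqn:E; [congruence|].
    assert (Ht : In t (patch tris z)) by (rewrite E; now left). apply in_patch in Ht as [Ht Hz].
    apply (patch_tri_closure O tris t _ Htri Ht). now apply vertex_in_tri. }
  destruct (classic (O z)) as [Oz|Oz].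
  - destruct (chain_maximal _ _ H2 H3 Hne) as [m [T [P [Hm [C Hend]]]]].
    destruct Hend as [Hc|[Hs _]].
    (* An unshared end spoke would be a boundary edge and would put [z] on the boundary. *)
    2: { exfalso. destruct C as [C1 [_ C3]]. destruct (C3 0%nat) as [X _]; [lia|].
         assert (H : boundary_edge O z (P 0%nat))
           by (apply (single_edge_boundary O tris z (T 0%nat)); auto).
         destruct (H z) as [_ Hn]; [|contradiction].
         exists 0. split; [lra|]. pt_ring. }
    assert (Hd := chain_cycle_doubled O tris z m T P Htri Hm C Hc).
    assert (Hin : forall t, (exists k, (k < m)%nat /\ t = T k) -> In t (patch tris z)).
    { intros t [k [Hk ->]]. now apply C. }
    apply (closed_patch_poincare (spoke tris z) _ (fun t => v t z - w) _
             (fun t p => / 2 * (v t z - v t p) ^ 2) m T P); auto.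
    + apply NoDup_patch.
    + intros t t' p Ht Ht' Hp Hp'. destruct (Nat.eq_dec t t') as [<-|Hn]; [|auto].
      assert (Hq := pow2_ge_0 (v t z - v t p)).
      replace (v t z - w - (v t z - w)) with 0 by ring. lra.
    + intros t Ht. apply (doubled_spokes_all O tris (fun t => exists k, (k < m)%nat /\ t = T k) z); auto.
      exists (T 0%nat), 0%nat. split; [lia|reflexivity].
    + apply NNPP; intros Hn.
      destruct (Rlt_irrefl w). specialize (Hint Oz).
      assert (Hpos : forall t, In t (patch tris z) -> w < v t z).
      { intros t Ht. apply Rnot_le_lt; intros X. apply Hn. exists t. split; [auto|lra]. }
      (* The patch is finite, so strict inequalities leave a uniform gap that survives convex
         combinations. *)
      assert (Hstrict : exists c, w < c /\ forall t, In t (patch tris z) -> c <= v t z).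
      { clear - Hpos. induction (patch tris z) as [|t l IH].
        - exists (w + 1). split; [lra|]. intros t [].
        - destruct IH as [c [Hc1 Hc2]]; [intros; apply Hpos; now right|].
          exists (Rmin c (v t z)). split.
          + apply Rmin_glb_lt; [exact Hc1|apply Hpos; now left].
          + intros t' [<-|Ht']; [apply Rmin_r|].
            eapply Rle_trans; [apply Rmin_l|auto]. }
      destruct Hstrict as [c [Hc1 Hc2]]. apply Rlt_le_trans with c; [exact Hc1|].
      apply (in_conv_lower_bound _ _ _ Hint). intros s [i [Hi [Hz ->]]]. apply Hc2. now apply in_patch.
    + apply NNPP; intros Hn.
      destruct (Rlt_irrefl w). specialize (Hint Oz).
      assert (Hneg : forall t, In t (patch tris z) -> v t z < w).
      { intros t Ht. apply Rnot_le_lt; intros X. apply Hn. exists t. split; [auto|lra]. }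
      assert (Hstrict : exists c, c < w /\ forall t, In t (patch tris z) -> v t z <= c).
      { clear - Hneg. induction (patch tris z) as [|t l IH].
        - exists (w - 1). split; [lra|]. intros t [].
        - destruct IH as [c [Hc1 Hc2]]; [intros; apply Hneg; now right|].
          exists (Rmax c (v t z)). split.
          + apply Rmax_lub_lt; [exact Hc1|apply Hneg; now left].
          + intros t' [<-|Ht']; [apply Rmax_r|].
            eapply Rle_trans; [|apply Rmax_l]. auto. }
      destruct Hstrict as [c [Hc1 Hc2]]. apply Rle_lt_trans with c; [|exact Hc1].
      apply (in_conv_upper_bound _ _ _ Hint). intros s [i [Hi [Hz ->]]]. apply Hc2. now apply in_patch.
  - assert (Hb : bdry O z) by (split; auto). rewrite (Hbd Hb) in *.
    apply (open_patch_poincare (spoke tris z) _ (fun t => v t z - 0) _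
             (fun t p => / 2 * (v t z - v t p) ^ 2)); auto.
    + apply NoDup_patch.
    + intros t p. assert (Hq := pow2_ge_0 (v t z - v t p)). lra.
    + intros t p Ht Hp Hu.
      assert (He : boundary_edge O z p) by (apply (single_edge_boundary O tris z t); auto).
      assert (Et := Hedge _ _ Ht Hp). apply in_patch in Ht as [Ht _].
      assert (Em := Hzero t z p Ht Et He). rewrite affine_mid in Em by auto.
      (* The zero at the midpoint makes the increment equal to [2 v t z]. *)
      replace (v t p) with (- v t z) by lra.
      right. field.
    + intros m T P Hm C Hc.
      refine (doubled_spokes_interior O tris (fun t => exists k, (k < m)%nat /\ t = T k) z
                HO Htri _ _ _ Hb).
      * intros t [k [Hk ->]]. now apply C.
      * apply (chain_cycle_doubled O tris z m T P); auto.
      * exists (T 0%nat), 0%nat. split; [lia|reflexivity].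
Qed.

(** * Summation of the vertex estimates *)

Lemma max_fold_ge (l : list nat) n : In n l -> (n <= fold_right Nat.max 0 l)%nat.
Proof.
  induction l as [|a l IH]; cbn; [tauto|]. intros [->|H]; [lia|]. specialize (IH H). lia.
Qed.

Lemma in_nodes tris z : In z (nodes tris) <-> is_node tris z.
Proof.
  unfold nodes, is_node. rewrite in_flat_map. split.
  - intros [T [HT Hz]]. destruct (In_nth _ _ dflt_tri HT) as [i [Hi <-]].
    exists i. split; [exact Hi|]. unfold is_vertex, triT. cbn in Hz. intuition.
  - intros [i [Hi Hz]]. exists (triT tris i). split; [now apply nth_In|].
    unfold is_vertex in Hz. cbn. intuition.
Qed.

Lemma length_patch tris z : length (patch tris z) = patch_size tris z.
Proof.
  unfold patch, patch_size, triT.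
  assert (K : forall (g : nat -> bool) s,
    length (filter g (map S s)) = length (filter (fun i => g (S i)) s)).
  { intros g s; induction s as [|a s IH]; [reflexivity|]. cbn [map filter].
    destruct (g (S a)); cbn [length]; now rewrite IH. }
  assert (H : forall l f, length (filter (fun i => f (nth i l dflt_tri)) (seq 0 (length l))) =
                          length (filter f l)).
  { induction l as [|T l IH]; intros f; [reflexivity|]. cbn [length seq filter nth].
    rewrite <- seq_shift. destruct (f T); cbn [length]; rewrite K; cbn [nth]; now rewrite IH. }
  apply H.
Qed.

Lemma patch_le_M O tris z :
  regular_triangulation O tris -> is_node tris z -> (length (patch tris z) <= M_patch O tris)%nat.
Proof.
  intros Htri Hz. rewrite length_patch.
  assert (Hc : closure O z).
  { destruct Hz as [i [Hi Hz]]. apply (patch_tri_closure O tris i _ Htri Hi). now apply vertex_in_tri. }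
  apply in_nodes in Hz. unfold M_patch, M_int, M_bd.
  destruct (classic (O z)) as [Oz|Oz].
  - eapply Nat.le_trans; [|apply Nat.le_max_l]. apply max_fold_ge, in_map, filter_In.
    split; [exact Hz|now apply propb_true].
  - eapply Nat.le_trans; [|apply Nat.le_max_r]. apply max_fold_ge, in_map, filter_In.
    split; [exact Hz|apply propb_true; now split].
Qed.

Lemma sqrt_le_scaled a b c : 0 <= c -> 0 <= b -> a <= c * b -> sqrt a <= sqrt c * sqrt b.
Proof. intros Hc Hb H. rewrite <- sqrt_mult by assumption. now apply sqrt_le_1_alt. Qed.

Lemma rsum_single (f : pt -> R) (l : list pt) a :
  NoDup l -> rsum (fun z => if pt_eq_dec z a then f z else 0) l =
             if in_dec pt_eq_dec a l then f a else 0.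
Proof.
  induction 1 as [|z l Hz Hl IH]; [reflexivity|].
  change (rsum _ (z :: l)) with ((if pt_eq_dec z a then f z else 0) +
     rsum (fun z => if pt_eq_dec z a then f z else 0) l). rewrite IH.
  destruct (pt_eq_dec z a) as [->|Hn]; destruct (in_dec pt_eq_dec a l) as [Hi|Hi];
    destruct (in_dec pt_eq_dec a _) as [Hj|Hj]; cbn in Hj; try ring; tauto.
Qed.

Lemma rsum_vertices (f : pt -> R) (l : list pt) T :
  0 < area T -> NoDup l ->
  rsum (fun z => if is_vertexb z T then f z else 0) l =
    (if in_dec pt_eq_dec (tA T) l then f (tA T) else 0) +
    (if in_dec pt_eq_dec (tB T) l then f (tB T) else 0) +
    (if in_dec pt_eq_dec (tC T) l then f (tC T) else 0).
Proof.
  intros HT Hl. rewrite <- !(rsum_single f) by exact Hl. rewrite <- !rsum_plus.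
  apply rsum_ext. intros z _. destruct T as [a b c]; cbn [tA tB tC].
  assert (Hs := corner_spread _ _ _ _ HT (corner_ABC a b c)).
  apply spread_neq in Hs as [N1 [N2 N3]]. unfold is_vertexb; cbn [tA tB tC].
  destruct (pt_eq_dec z a), (pt_eq_dec z b), (pt_eq_dec z c); try congruence; ring.
Qed.

Lemma error_le_vertices tris v w O i :
  regular_triangulation O tris -> CR10 O tris v -> S10 O tris w -> (i < length tris)%nat ->
  err_sq_T tris v w i <= sqrt 3 / 12 *
    ((v i (tA (triT tris i)) - w (tA (triT tris i))) ^ 2 +
     (v i (tB (triT tris i)) - w (tB (triT tris i))) ^ 2 +
     (v i (tC (triT tris i)) - w (tC (triT tris i))) ^ 2).
Proof.
  intros Htri [Haff _] [HS _] Hi. unfold err_sq_T.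
  assert (HT := regular_area _ _ _ Htri Hi). set (T := triT tris i) in *.
  destruct (Haff i Hi) as [a [b [c Hv]]]. destruct (HS i Hi) as [g [[a' [b' [c' Hg]]] Hw]].
  fold T in Hw. set (k := / diam T).
  rewrite (tri_integral_affine_sq T _ (fun x => k * (v i x - g x))).
  2: { exists (k * (a - a')), (k * (b - b')), (k * (c - c')). intros x. rewrite Hv, Hg. ring. }
  2: { intros x Hx. now rewrite (Hw x Hx). }
  rewrite !Hw by (apply vertex_in_tri; unfold is_vertex; auto).
  unfold quad_mass.
  set (x := v i (tA T) - g (tA T)). set (y := v i (tB T) - g (tB T)). set (z := v i (tC T) - g (tC T)).
  assert (Hd := area_le_diam T).
  assert (Hd0 : diam T <> 0) by (intros E; rewrite E in Hd; lra).
  assert (Hk : area T * k ^ 2 <= sqrt 3 / 4).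
  { apply Rmult_le_compat_r with (r := k ^ 2) in Hd; [|apply pow2_ge_0].
    replace (sqrt 3 / 4 * diam T ^ 2 * k ^ 2) with (sqrt 3 / 4) in Hd by (unfold k; field; exact Hd0).
    exact Hd. }
  assert (X := pow2_ge_0 (x - y)). assert (Y := pow2_ge_0 (y - z)). assert (Z := pow2_ge_0 (z - x)).
  assert (Hx := pow2_ge_0 x). assert (Hy := pow2_ge_0 y). assert (Hz := pow2_ge_0 z).
  replace (area T / 12 * _) with (area T * k ^ 2 * ((x ^ 2 + y ^ 2 + z ^ 2 + (x + y + z) ^ 2) / 12)) by field.
  (* This is [(x + y + z)^2 <= 3 (x^2 + y^2 + z^2)]. *)
  apply Rle_trans with (area T * k ^ 2 * ((x ^ 2 + y ^ 2 + z ^ 2) / 3)).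
  - apply Rmult_le_compat_l; [|lra]. apply Rmult_le_pos; [lra|apply pow2_ge_0].
  - replace (sqrt 3 / 12 * _) with (sqrt 3 / 4 * ((x ^ 2 + y ^ 2 + z ^ 2) / 3)) by field.
    apply Rmult_le_compat_r; [lra|exact Hk].
Qed.

(** Extended by zero off the vertices, so that sums over triangles and over nodes have full ranges
    and can be exchanged. *)
Definition vertex_error (v : nat -> pt -> R) (w : pt -> R) (tris : list tri) (i : nat) (z : pt) : R :=
  if is_vertexb z (triT tris i) then (v i z - w z) ^ 2 else 0.

(** The list [Z] is kept free: all nodes yield the global bound, the three vertices of one triangle
    the local bound with the same constant. *)
Lemma nodes_estimate O tris omega0 v w Z :
  lipschitz_domain O -> regular_triangulation O tris -> 0 < omega0 ->
  (forall i, (i < length tris)%nat -> min_angle_ge (triT tris i) omega0) ->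
  CR10 O tris v -> S10 O tris w ->
  (forall z, is_node tris z -> O z ->
     in_conv_R (fun y => exists i, (i < length tris)%nat /\
                   is_vertex z (triT tris i) /\ y = v i z) (w z)) ->
  NoDup Z -> (forall z, In z Z -> is_node tris z) -> (1 <= M_patch O tris)%nat ->
  sqrt 3 / 12 * rsum (fun z => rsum (fun i => vertex_error v w tris i z) (seq 0 (length tris))) Z <=
    sqrt 3 / 2 * cot omega0 / (1 - cos (PI / INR (M_patch O tris))) *
    rsum (grad_sq_T tris v)
      (filter (fun i => propb (exists z, In z Z /\ is_vertex z (triT tris i))) (seq 0 (length tris))).
Proof.
  intros HO Htri Hom Hang Hv Hw Hconv HZ Hnode HM.
  destruct (path_constant_le _ HM) as [Hc1 Hc2].
  set (c := 1 - cos (PI / INR (M_patch O tris))) in *.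
  set (n := length tris) in *.
  assert (Hstep1 : forall z, In z Z ->
    rsum (fun i => vertex_error v w tris i z) (seq 0 n) <=
    / c * rsum (fun i => if is_vertexb z (triT tris i)
                         then spoke_energy (v i) z (triT tris i) else 0) (seq 0 n)).
  { intros z Hz. unfold vertex_error. rewrite <- !rsum_filter. fold (patch tris z).
    change (filter _ (seq 0 n)) with (patch tris z).
    eapply Rle_trans.
    - apply (node_estimate O tris v (w z) z); auto. now apply Hw.
    - apply Rmult_le_compat_r.
      + apply rsum_nonneg. intros; apply spoke_energy_ge0.
      + eapply Rle_trans; [|exact Hc2].
        assert (X : INR (length (patch tris z)) <= INR (M_patch O tris))
          by (apply le_INR, patch_le_M; auto).
        assert (Y := pos_INR (length (patch tris z))). nra. }
  apply rsum_le in Hstep1. rewrite rsum_scal in Hstep1.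
  rewrite (rsum_exchange (fun z i => if is_vertexb z (triT tris i)
                         then spoke_energy (v i) z (triT tris i) else 0)) in Hstep1.
  assert (Hstep2 : forall i, In i (seq 0 n) ->
    rsum (fun z => if is_vertexb z (triT tris i) then spoke_energy (v i) z (triT tris i) else 0) Z <=
    6 * cot omega0 * (if propb (exists z, In z Z /\ is_vertex z (triT tris i))
                      then grad_sq_T tris v i else 0)).
  { intros i Hi. apply in_seq in Hi. assert (Hi' : (i < length tris)%nat) by (fold n; lia).
    assert (HT := regular_area _ _ _ Htri Hi').
    destruct (propb _) eqn:E.
    - rewrite rsum_vertices by auto.
      eapply Rle_trans; [|apply edge_differences_le; auto; now apply Hv].
      set (f := v i). set (T := triT tris i).
      (* Vertices outside [Z] are added for free; with all three present, each edge occurs twice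
         with the factor one half. *)
      assert (K : forall y l, (if in_dec pt_eq_dec y l then spoke_energy f y T else 0) <= spoke_energy f y T).
      { intros y l. destruct in_dec; [lra|apply spoke_energy_ge0]. }
      assert (K1 := K (tA T) Z). assert (K2 := K (tB T) Z). assert (K3 := K (tC T) Z).
      eapply Rle_trans; [apply Rplus_le_compat; [apply Rplus_le_compat|]; [exact K1|exact K2|exact K3]|].
      right. unfold spoke_energy. field.
    - rewrite (rsum_ext _ (fun _ => 0 * 0)).
      + rewrite rsum_scal. lra.
      + intros z Hz. destruct (is_vertexb z (triT tris i)) eqn:V; [|ring]. exfalso.
        apply is_vertexb_spec in V.
        assert (X : propb (exists z, In z Z /\ is_vertex z (triT tris i)) = true)
          by (apply propb_true; now exists z).
        congruence. }
  apply rsum_le in Hstep2. rewrite rsum_scal, <- rsum_filter in Hstep2.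
  assert (Hci : 0 <= / c) by (left; now apply Rinv_0_lt_compat).
  assert (H3 := sqrt_pos 3).
  eapply Rle_trans; [apply Rmult_le_compat_l; [lra|exact Hstep1]|].
  eapply Rle_trans; [apply Rmult_le_compat_l; [lra|apply Rmult_le_compat_l; [exact Hci|exact Hstep2]]|].
  right. field. lra.
Qed.

Lemma M_patch_pos O tris i :
  regular_triangulation O tris -> (i < length tris)%nat -> (1 <= M_patch O tris)%nat.
Proof.
  intros Htri Hi. set (z := tA (triT tris i)).
  assert (Hz : is_vertex z (triT tris i)) by (unfold is_vertex; auto).
  eapply Nat.le_trans; [|apply (patch_le_M O tris z Htri); now exists i].
  assert (H : In i (patch tris z)) by now apply in_patch.
  destruct (patch tris z); [destruct H|cbn; lia].
Qed.

Lemma vertex_errors_sum tris v w O Z i :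
  regular_triangulation O tris -> CR10 O tris v -> S10 O tris w -> (i < length tris)%nat ->
  NoDup Z -> (forall z, is_vertex z (triT tris i) -> In z Z) ->
  err_sq_T tris v w i <= sqrt 3 / 12 * rsum (vertex_error v w tris i) Z.
Proof.
  intros Htri Hv Hw Hi HZ Hin.
  eapply Rle_trans; [now apply (error_le_vertices tris v w O)|].
  unfold vertex_error.
  rewrite (rsum_vertices (fun z => (v i z - w z) ^ 2) Z _ (regular_area _ _ _ Htri Hi) HZ).
  repeat (destruct in_dec as [?|Hn];
    [|exfalso; apply Hn, Hin; unfold is_vertex; auto]).
  lra.
Qed.

Theorem theorem4p2
  (Omega : pt -> Prop) (tris : list tri) (omega0 : R)
  (HOm : lipschitz_domain Omega)
  (Htri : regular_triangulation Omega tris)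
  (Hom0 : 0 < omega0)
  (Hang : forall i, (i < length tris)%nat -> min_angle_ge (triT tris i) omega0)
  (J : (nat -> pt -> R) -> pt -> R)
  (HJS : forall v, CR10 Omega tris v -> S10 Omega tris (J v))
  (HJconv : forall v, CR10 Omega tris v ->
     forall z, is_node tris z -> Omega z ->
       in_conv_R (fun y => exists i, (i < length tris)%nat /\
                     is_vertex z (triT tris i) /\ y = v i z) (J v z))
  (v : nat -> pt -> R) (Hv : CR10 Omega tris v) :
  let c_apx := sqrt (sqrt 3 / 2 * cot omega0 /
                     (1 - cos (PI / INR (M_patch Omega tris)))) in
  sqrt (sum_idx (length tris) (fun _ => true) (err_sq_T tris v (J v)))
    <= c_apx * sqrt (sum_idx (length tris) (fun _ => true) (grad_sq_T tris v)) /\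
  forall i, (i < length tris)%nat ->
    sqrt (err_sq_T tris v (J v) i)
      <= c_apx * sqrt (sum_idx (length tris)
                         (fun j => shares_vertex (triT tris i) (triT tris j))
                         (grad_sq_T tris v)).
Proof.
  assert (Hw := HJS v Hv). assert (Hconv := HJconv v Hv).
  set (w := J v) in *. clearbody w. clear J HJS HJconv.
  assert (Hedge : forall j, (j < length tris)%nat -> 0 <= cot omega0 /\ 0 <= grad_sq_T tris v j).
  { intros j Hj. destruct Hv as [Haff _]. destruct (Haff j Hj) as [a [b [c Hf]]].
    split.
    - apply (edge_differences_le (triT tris j) omega0 (v j));
        [eapply regular_area; eauto|auto|auto|now exists a, b, c].
    - unfold grad_sq_T. rewrite (tri_integral_const _ _ (b ^ 2 + c ^ 2)).
      + assert (HT := regular_area _ _ _ Htri Hj). assert (X := pow2_ge_0 b). assert (Y := pow2_ge_0 c).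
        apply Rmult_le_pos; lra.
      + intros x. unfold grad_sq. now rewrite (d1_affine (v j) a b c), (d2_affine (v j) a b c). }
  assert (Hsum : forall P, 0 <= sum_idx (length tris) P (grad_sq_T tris v)).
  { intros P. apply (rsum_nonneg (grad_sq_T tris v)). intros j Hj.
    apply filter_In in Hj as [Hj _]. apply in_seq in Hj. apply Hedge; lia. }
  assert (Hc : forall i, (i < length tris)%nat ->
     0 <= sqrt 3 / 2 * cot omega0 / (1 - cos (PI / INR (M_patch Omega tris)))).
  { intros i Hi. destruct (path_constant_le _ (M_patch_pos _ _ _ Htri Hi)) as [Hp _].
    destruct (Hedge i Hi) as [Hcot _]. assert (H3 := sqrt_pos 3).
    apply Rmult_le_pos; [apply Rmult_le_pos; lra|left; now apply Rinv_0_lt_compat]. }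
  split.
  (* Without triangles there is no bound [1 <= M_patch] to control the constant, but both sums are
     empty. *)
  - destruct (Nat.eq_dec (length tris) 0) as [E|E].
    { rewrite E. unfold sum_idx; cbn. rewrite sqrt_0. lra. }
    assert (H0 : (0 < length tris)%nat) by lia.
    apply sqrt_le_scaled; [now apply (Hc 0%nat)|apply Hsum|].
    set (Z := nodup pt_eq_dec (nodes tris)).
    assert (HZn : forall z, In z Z <-> is_node tris z)
      by (intros z; unfold Z; rewrite nodup_In; apply in_nodes).
    assert (H := nodes_estimate Omega tris omega0 v w Z HOm Htri Hom0 Hang Hv Hw Hconv
                   (NoDup_nodup _ _) (fun z => proj1 (HZn z)) (M_patch_pos _ _ _ Htri H0)).
    rewrite (filter_ext_in _ (fun _ => true)) in H.
    2: { intros i Hi. apply in_seq in Hi. apply propb_true. exists (tA (triT tris i)).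
         assert (X : is_vertex (tA (triT tris i)) (triT tris i)) by (unfold is_vertex; auto).
         split; [|exact X]. apply HZn. exists i. split; [lia|exact X]. }
    eapply Rle_trans; [|exact H].
    rewrite (rsum_exchange (fun z i => vertex_error v w tris i z)), <- rsum_scal.
    unfold sum_idx.
    replace (filter (fun _ : nat => true) (seq 0 (length tris))) with (seq 0 (length tris))
      by (symmetry; apply filter_true).
    apply rsum_le. intros i Hi. apply in_seq in Hi.
    apply (vertex_errors_sum tris v w Omega); auto; [lia|apply NoDup_nodup|].
    intros z Hz. apply HZn. exists i. split; [lia|exact Hz].
  - intros i Hi. apply sqrt_le_scaled; [now apply (Hc i)|apply Hsum|].
    set (T := triT tris i).
    set (Z := (tA T :: tB T :: tC T :: nil)%list).
    assert (HZT : forall z, In z Z <-> is_vertex z T).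
    { intros z. unfold Z, is_vertex. cbn. intuition. }
    assert (HZ : NoDup Z).
    { assert (HT : 0 < area T) by (eapply regular_area; eauto). unfold Z.
      destruct T as [a b c]; cbn [tA tB tC].
      assert (Hs := corner_spread _ _ _ _ HT (corner_ABC a b c)).
      apply spread_neq in Hs as [N1 [N2 N3]].
      repeat constructor; cbn; intuition. }
    assert (H := nodes_estimate Omega tris omega0 v w Z HOm Htri Hom0 Hang Hv Hw Hconv HZ
                   (fun z Hz => ex_intro _ i (conj Hi (proj1 (HZT z) Hz))) (M_patch_pos _ _ _ Htri Hi)).
    rewrite (filter_ext _ (fun j => shares_vertex T (triT tris j))) in H.
    2: { intros j. apply eq_true_iff_eq. rewrite propb_true. unfold shares_vertex, Z.
         rewrite !orb_true_iff, !is_vertexb_spec. split.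
         - intros [z [[<-|[<-|[<-|[]]]] Hz]]; auto.
         - intros [[Hz|Hz]|Hz]; eexists; (split; [|exact Hz]); cbn; auto. }
    eapply Rle_trans; [|exact H].
    rewrite (rsum_exchange (fun z i => vertex_error v w tris i z)).
    eapply Rle_trans; [apply (vertex_errors_sum tris v w Omega Z); auto; now intros; apply HZT|].
    apply Rmult_le_compat_l; [assert (H3 := sqrt_pos 3); lra|].
    (* The node sums contain the errors of all triangles at the vertices of [T]; only those of [T]
       itself are kept. *)
    apply (rsum_ge_term (fun j => rsum (fun z => vertex_error v w tris j z) Z));
      [|apply in_seq; lia].
    intros j _. apply rsum_nonneg. intros z _. unfold vertex_error.
    destruct is_vertexb; [apply pow2_ge_0|lra].
Qed.
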